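(* Let $A$ be a Banach algebra such that every closed ideal of $A$ admits a quasi-central approximate identity in $A$. Then, for any closed ideal $I$ in $A$, $$\overline{[I,I]}=\overline{[I,A]}=\overline{[I,[I,A]]}=I\cap\overline{[A,A]}.$$ In particular, if $A$ is a $C^*$-algebra with no tracial states, then $\overline{[I,A]}=I$.
   Context: All algebras are complex and ideals are two-sided. For elements $x,y$, $[x,y]:=xy-yx$; for subspaces $X,Y$ of $A$, $[X,Y]:=\mathrm{span}\{[x,y]:x\in X,\,y\in Y\}$. Bars denote norm closures. A tracial state on a $C^*$-algebra is a positive linear functional $\varphi$ of norm one with $\varphi(ab)=\varphi(ba)$ for all $a,b$. A quasi-central approximate identity for an ideal $I$ in a Banach algebra $A$ is a net $\{e_\lambda\}$ in $I$ with $\sup_\lambda\|e_\lambda\|<\infty$ and $\lim_\lambda\|xe_\lambda-x\|=\lim_\lambda\|e_\lambda x-x\|=\lim_\lambda\|e_\lambda a-ae_\lambda\|=0$ for all $x\in I$, $a\in A$. *)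

(* Defs.v *)
From HB Require Import structures.
From mathcomp Require Import all_boot all_order all_algebra.
From mathcomp Require Import complex.
From mathcomp Require Import boolp classical_sets reals topology normedtype.

Set Implicit Arguments.
Unset Strict Implicit.
Unset Printing Implicit Defensive.

Import Order.TTheory GRing.Theory Num.Theory.
Import numFieldNormedType.Exports.

Local Open Scope classical_set_scope.
Local Open Scope ring_scope.

Reserved Notation "x ** y" (at level 40, left associativity).

(* The multiplication is not required to have a unit, so the ring structures of
   MathComp do not apply and the product is introduced from scratch. *)
HB.mixin Record isBanachAlgebra (R : realType) A
    of CompleteNormedModule R[i] A := {
  bmul : A -> A -> A ;
  bmulA : forall x y z : A, bmul x (bmul y z) = bmul (bmul x y) z ;
  bmulDl : forall x y z : A, bmul (x + y) z = bmul x z + bmul y z ;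
  bmulDr : forall x y z : A, bmul x (y + z) = bmul x y + bmul x z ;
  bscalerAl : forall (c : R[i]) (x y : A), bmul (c *: x) y = c *: bmul x y ;
  bscalerAr : forall (c : R[i]) (x y : A), bmul x (c *: y) = c *: bmul x y ;
  bnormM : forall x y : A, `|bmul x y| <= `|x| * `|y|
}.

#[short(type="banachAlgType")]
HB.structure Definition BanachAlgebra (R : realType) :=
  {A of isBanachAlgebra R A & CompleteNormedModule R[i] A}.

Notation "x ** y" := (bmul x y) : ring_scope.

HB.mixin Record isCStarAlgebra (R : realType) A of BanachAlgebra R A := {
  star : A -> A ;
  starK : forall x : A, star (star x) = x ;
  starD : forall x y : A, star (x + y) = star x + star y ;
  starZ : forall (c : R[i]) (x : A), star (c *: x) = (c^*)%R *: star x ;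
  starM : forall x y : A, star (x ** y) = star y ** star x ;
  normrCstar : forall x : A, `|star x ** x| = `|x| ^+ 2
}.

#[short(type="cstarAlgType")]
HB.structure Definition CStarAlgebra (R : realType) :=
  {A of isCStarAlgebra R A & BanachAlgebra R A}.

Section Banach.
Context {R : realType} {A : banachAlgType R}.
Implicit Types (x y a : A) (S X Y I : set A).

Definition linear_subspace S : Prop :=
  S 0 /\ forall (c : R[i]) x y, S x -> S y -> S (c *: x + y).

Definition linear_span S : set A := smallest linear_subspace S.

Definition commutator x y : A := x ** y - y ** x.

Definition commspan X Y : set A :=
  linear_span [set commutator x y | x in X & y in Y].

Definition ideal I : Prop :=
  linear_subspace I /\ forall a x, I x -> I (a ** x) /\ I (x ** a).

Definition closed_ideal I : Prop := ideal I /\ closed I.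

Definition directed (L : Type) (le : L -> L -> Prop) : Prop :=
  [/\ inhabited L,
      forall l, le l l,
      forall l m n, le l m -> le m n -> le l n &
      forall l m, exists n, le l n /\ le m n].

(* Convergence of a net is convergence along the filter of tails of its
   index set. *)
Definition net_tails (L : Type) (le : L -> L -> Prop) : set_system L :=
  [set P | exists l0, forall l, le l0 l -> P l].

Definition quasi_central_approximate_identity
    (I : set A) (L : Type) (le : L -> L -> Prop) (e : L -> A) : Prop :=
  [/\ directed le,
      forall l, I (e l),
      exists M : R[i], forall l, `|e l| <= M,
      forall x, I x ->
        `|x ** e l - x| @[l --> net_tails le] --> (0 : R[i]^o) /\
        `|e l ** x - x| @[l --> net_tails le] --> (0 : R[i]^o) &
      forall a, `|e l ** a - a ** e l| @[l --> net_tails le] --> (0 : R[i]^o)].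

Definition admits_qcai I : Prop :=
  exists (L : Type) (le : L -> L -> Prop) (e : L -> A),
    quasi_central_approximate_identity I le e.

(* The norms of A and of R[i] take their values in R[i], whence the projection
   Re; sup is 0 on an unbounded set, so that a functional of norm one is
   necessarily bounded. *)
Definition functional_norm (phi : A -> R[i]) : R :=
  sup [set complex.Re `|phi a| | a in [set a | `|a| <= 1]].

End Banach.

Definition tracial_state {R : realType} {A : cstarAlgType R}
    (phi : {scalar A}) : Prop :=
  [/\ forall a : A, 0 <= phi (star a ** a),
      functional_norm phi = 1 &
      forall a b : A, phi (a ** b) = phi (b ** a)].

(* Main.v *)
(* Let L be the closure of [I,[I,A]], a Lie ideal, and N = {x : [x,A] <= L}, a
   subalgebra containing L. As [u,v] a = [u,va] - v [u,a], the ideal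
   M = {x : x A <= N} contains [L,L]. Closed ideals being semiprime thanks to
   their approximate identities, Herstein's arguments modulo M put [I,I], then
   [I,A], in M. For every closed ideal J, multiplying sums of commutators by a
   quasi-central approximate identity of J gives
   J /\ cl [A,A] <= cl [J,A]; with J = M this yields [I,A] <= cl [M,A] <= L.

   In the C*-case, suppose that I is not the closure of [I,A], and take a bounded
   real functional f killing [I,A] but not I. Then
     F(T) = sup {sum f(z_i z_i^* ) : z_i in I, sum z_i^* z_i <= T}
   is finite on the positive multipliers T of A, additive by Riesz decomposition
   and tracial; up to a rotation of f it is nonzero, and its linear extension is a
   multiple of a tracial state. *)

(* Semiprimeness is available only modulo closed ideals, and [L] is merely a Lie ideal; this is why
   Herstein's cancellations are carried out modulo [M] and brought back to [L] at the end.

   In the C*-case [A] may have no unit and positivity is built from norms alone: [T] is positive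
   when it is self-adjoint and |t - T| <= t for some t >= 0, and roots are limits of a Picard
   iteration. The unit of the multiplier algebra then writes a self-adjoint a as the difference of a
   + |a| and |a|, both in the domain of [F].

   The functional f has no sign, so the supremum in [F] selects a positive part. Only families in
   [I] enter, so f has to be tracial only against [I], whereas [F] is tracial for all multipliers.
   The rotations -f, f(i .), -f(i .) satisfy the same hypotheses as f. If none of the four were
   positive at some w w^* with w in [I], then f would vanish at the products x u^* of elements of
   [I], and these approximate every element of [I]. *)
From HB Require Import structures.
Require Import Defs.
From mathcomp Require Import all_boot all_order all_algebra.
From mathcomp Require Import complex.
From mathcomp Require Import ring lra.
From mathcomp Require Import boolp classical_sets reals topology normedtype.

Set Implicit Arguments.
Unset Strict Implicit.
Unset Printing Implicit Defensive.

Import Order.TTheory GRing.Theory Num.Theory.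
Import numFieldNormedType.Exports.

Local Open Scope classical_set_scope.
Local Open Scope ring_scope.
Local Open Scope complex_scope.

(* Decision of linear identities in a module: after distributing, identities in
   noncommutative algebras are linear in the monomials. *)
Section LinearExpr.
Context {K : comNzRingType} {V : lmodType K}.

Inductive lexpr :=
| LVar of nat
| LZero
| LAdd of lexpr & lexpr
| LOpp of lexpr
| LScale of K & lexpr.

Fixpoint leval (env : seq V) (e : lexpr) : V :=
  match e with
  | LVar n => nth 0 env n
  | LZero => 0
  | LAdd e1 e2 => leval env e1 + leval env e2
  | LOpp e1 => - leval env e1
  | LScale k e1 => k *: leval env e1
  end.

Fixpoint lcoef (e : lexpr) (i : nat) : K :=
  match e with
  | LVar n => if eqn n i then 1 else 0
  | LZero => 0
  | LAdd e1 e2 => lcoef e1 i + lcoef e2 i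
  | LOpp e1 => - lcoef e1 i
  | LScale k e1 => k * lcoef e1 i
  end.

Lemma leval_coef env e :
  leval env e = \sum_(i < size env) lcoef e i *: nth 0 env i.
Proof.
elim: e => /= [n||e1 -> e2 ->|e1 ->|k e1 ->].
- have [nenv|nenv] := ltnP n (size env).
    rewrite (bigD1 (Ordinal nenv))//= eqnE eqxx scale1r big1 ?addr0// => i ni.
    by rewrite eq_sym (negbTE ni : (i : nat) == n = false) scale0r.
  rewrite nth_default// big1// => i _; rewrite eqnE; case: eqP => [ni|].
    by move: (ltn_ord i); rewrite -ni ltnNge nenv.
  by rewrite scale0r.
- by rewrite big1// => i _; rewrite scale0r.
- by rewrite -big_split/=; apply: eq_bigr => i _; rewrite scalerDl.
- by rewrite -sumrN; apply: eq_bigr => i _; rewrite scaleNr.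
- by rewrite scaler_sumr; apply: eq_bigr => i _; rewrite scalerA.
Qed.

Lemma lexpr_eq env e1 e2 :
  foldr (fun i P => lcoef e1 i = lcoef e2 i /\ P) True (iota 0 (size env)) ->
  leval env e1 = leval env e2.
Proof.
move=> h; rewrite !leval_coef; apply: eq_bigr => i _; congr (_ *: _).
have : (i : nat) \in iota 0 (size env) by rewrite mem_iota ltn_ord.
elim: (iota _ _) h => //= j s ih [hj /ih hs].
by rewrite in_cons => /predU1P[->|].
Qed.

End LinearExpr.

(* Occurrences of one monomial may carry different structure instances. *)
Ltac lin_same x y :=
  match constr:((x, y)) with
  | ((?a * ?b)%R, (?c * ?d)%R) => let _ := lin_same a c in lin_same b d
  | (1%R, 1%R) => constr:(tt)
  | (?a, ?a) => constr:(tt)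
  end.

Ltac lin_index x env :=
  match env with
  | ?y :: _ => let _ := lin_same x y in constr:(0%N)
  | _ :: ?s => let n := lin_index x s in constr:(S n)
  end.

Ltac lin_atoms x env :=
  match x with
  | (?a + ?b)%R => let env := lin_atoms a env in lin_atoms b env
  | (- ?a)%R => lin_atoms a env
  | (_ *: ?a)%R => lin_atoms a env
  | 0%R => env
  | _ => match env with
         | _ => let n := lin_index x env in env
         | _ => constr:(x :: env)
         end
  end.

Ltac lin_reify K x env :=
  match x with
  | (?a + ?b)%R => let a := lin_reify K a env in
      let b := lin_reify K b env in constr:(@LAdd K a b)
  | (- ?a)%R => let a := lin_reify K a env in constr:(@LOpp K a)
  | (?k *: ?a)%R => let a := lin_reify K a env in constr:(@LScale K k a)
  | 0%R => constr:(@LZero K)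
  | _ => let n := lin_index x env in constr:(@LVar K n)
  end.

Ltac linear_eq K V :=
  match goal with
  | |- ?x = ?y =>
    let env := lin_atoms x (@nil V) in
    let env := lin_atoms y env in
    let e1 := lin_reify K x env in
    let e2 := lin_reify K y env in
    apply: (@lexpr_eq K V env e1 e2); rewrite /=; repeat split
  end.

(** * Real-valued norms, commutators and linear subspaces *)

Section RealComplex.
Context {R : realType}.
Implicit Types (r s : R) (c : R[i]).

Lemma rcD r s : (r + s)%:C = r%:C + s%:C :> R[i].
Proof. exact: rmorphD. Qed.

Lemma rcN r : (- r)%:C = - r%:C :> R[i].
Proof. exact: rmorphN. Qed.

Lemma rcM r s : (r * s)%:C = r%:C * s%:C :> R[i].
Proof. exact: rmorphM. Qed.

Lemma Re_norm c : (complex.Re `|c|)%:C = `|c|.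
Proof. by rewrite RRe_real ?ger0_real. Qed.

Lemma Re_norm_ge0 c : 0 <= complex.Re `|c|.
Proof. by rewrite -lecR Re_norm normr_ge0. Qed.

End RealComplex.

Section Norm.
Context {R : realType} {A : banachAlgType R}.
Implicit Types (x y z a : A) (S X Y I : set A) (c : R[i]) (r e : R).

(** Estimates are carried out in [R], where the order is total and suprema exist. *)
Definition nrm x : R := complex.Re `|x|.

Lemma nrmE x : `|x| = (nrm x)%:C.
Proof. by rewrite /nrm RRe_real ?ger0_real. Qed.

Lemma nrm_ge0 x : 0 <= nrm x.
Proof. by rewrite -lecR -nrmE normr_ge0. Qed.

Lemma nrm_le x r : (`|x| <= r%:C) = (nrm x <= r).
Proof. by rewrite nrmE lecR. Qed.

Lemma nrm_lt x r : (`|x| < r%:C) = (nrm x < r).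
Proof. by rewrite nrmE ltcR. Qed.

Lemma nrm0 : nrm 0 = 0.
Proof. by rewrite /nrm normr0. Qed.

Lemma nrm_eq0 x : nrm x = 0 -> x = 0.
Proof. by move=> h; apply/normr0_eq0; rewrite nrmE h. Qed.

Lemma nrmN x : nrm (- x) = nrm x.
Proof. by rewrite /nrm normrN. Qed.

Lemma nrmB x y : nrm (x - y) = nrm (y - x).
Proof. by rewrite -nrmN opprB. Qed.

Lemma nrmD x y : nrm (x + y) <= nrm x + nrm y.
Proof. by rewrite -lecR rcD -!nrmE ler_normD. Qed.

Lemma nrm_dist x y z : nrm (x - z) <= nrm (x - y) + nrm (y - z).
Proof. by rewrite (le_trans _ (nrmD _ _))// addrA subrK. Qed.

Lemma nrmM x y : nrm (x ** y) <= nrm x * nrm y.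
Proof. by rewrite -lecR rcM -!nrmE bnormM. Qed.

Lemma nrmZ c x : nrm (c *: x) = complex.Re `|c| * nrm x.
Proof.
by apply: (@complexI R); rewrite rcM -!nrmE normrZ Re_norm.
Qed.

Lemma nrmZr r x : nrm (r%:C *: x) = `|r| * nrm x.
Proof. by rewrite nrmZ normc_def /= expr0n addr0 sqrtr_sqr. Qed.

Lemma closure_nrm S x :
  closure S x <-> forall e, 0 < e -> exists2 y, S y & nrm (x - y) < e.
Proof.
split=> [clx e e0|hx B].
  have /clx[y [Sy]] : nbhs x (ball x e%:C) by apply: nbhsx_ballx; rewrite ltcR.
  by rewrite -ball_normE /= nrm_lt => xy; exists y.
move=> /nbhs_ballP[e /= e0 eB].
have er : e = (complex.Re e)%:C by rewrite RRe_real// gtr0_real.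
move: e0 eB; rewrite er ltcR => e0 eB.
have [y Sy xy] := hx _ e0.
by exists y; split=> //; apply: eB; rewrite -ball_normE /= nrm_lt.
Qed.

Lemma closedP S : closed S ->
  forall x, (forall e, 0 < e -> exists2 y, S y & nrm (x - y) < e) -> S x.
Proof. by move=> cS x hx; apply: cS; apply/closure_nrm. Qed.

Lemma bmul0l x : 0 ** x = 0.
Proof. by apply: (addrI (0 ** x)); rewrite -bmulDl !addr0. Qed.

Lemma bmul0r x : x ** 0 = 0.
Proof. by apply: (addrI (x ** 0)); rewrite -bmulDr !addr0. Qed.

Lemma bmulNl x y : (- x) ** y = - (x ** y).
Proof. by apply: (addrI (x ** y)); rewrite -bmulDl !subrr bmul0l. Qed.

Lemma bmulNr x y : x ** (- y) = - (x ** y).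
Proof. by apply: (addrI (x ** y)); rewrite -bmulDr !subrr bmul0r. Qed.

Lemma bmulBl x y z : (x - y) ** z = x ** z - y ** z.
Proof. by rewrite bmulDl bmulNl. Qed.

Lemma bmulBr x y z : z ** (x - y) = z ** x - z ** y.
Proof. by rewrite bmulDr bmulNr. Qed.

Lemma commutatorN x y : commutator y x = - commutator x y.
Proof. by rewrite /commutator opprB. Qed.

Lemma commutatorDl x y z :
  commutator (x + y) z = commutator x z + commutator y z.
Proof. by rewrite /commutator bmulDl bmulDr opprD addrACA. Qed.

Lemma commutatorDr x y z :
  commutator z (x + y) = commutator z x + commutator z y.
Proof. by rewrite !(commutatorN _ z) commutatorDl opprD. Qed.

Lemma commutatorZl c x y : commutator (c *: x) y = c *: commutator x y.
Proof. by rewrite /commutator bscalerAl bscalerAr scalerBr. Qed.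

Lemma commutatorZr c x y : commutator y (c *: x) = c *: commutator y x.
Proof. by rewrite /commutator bscalerAl bscalerAr scalerBr. Qed.

Lemma commutator0l x : commutator 0 x = 0.
Proof. by rewrite /commutator bmul0l bmul0r subrr. Qed.

Lemma commutator0r x : commutator x 0 = 0.
Proof. by rewrite /commutator bmul0l bmul0r subrr. Qed.

Lemma commutatorBl x y z :
  commutator (x - y) z = commutator x z - commutator y z.
Proof. by rewrite commutatorDl -scaleN1r commutatorZl scaleN1r. Qed.

Lemma commutatorBr x y z :
  commutator z (x - y) = commutator z x - commutator z y.
Proof. by rewrite !(commutatorN _ z) commutatorBl -opprD. Qed.

Lemma commutator_mulr x y z :
  commutator x (y ** z) = commutator x y ** z + y ** commutator x z.
Proof.
by rewrite /commutator bmulBl bmulBr !bmulA addrA subrK.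
Qed.

Lemma commutator_mull x y z :
  commutator (x ** y) z = commutator x z ** y + x ** commutator y z.
Proof.
by rewrite /commutator bmulBl bmulBr !bmulA [RHS]addrC addrA subrK.
Qed.

Lemma commutator_jacobi x y z : commutator x (commutator y z) =
  commutator (commutator x y) z + commutator y (commutator x z).
Proof.
rewrite {2}/commutator commutatorBr !commutator_mulr /commutator.
by rewrite opprD [X in _ + X = _]addrC addrACA.
Qed.

Lemma nrm_commutator x y : nrm (commutator x y) <= 2 * nrm x * nrm y.
Proof.
rewrite (le_trans (nrmD _ _))// nrmN -mulrA mulrDl mul1r lerD ?nrmM//.
by rewrite mulrC nrmM.
Qed.

Section Subspace.
Variable (S : set A) (sS : linear_subspace S).

Lemma subspace0 : S 0. Proof. by case: sS. Qed.

Lemma subspaceD x y : S x -> S y -> S (x + y).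
Proof. by move=> Sx Sy; rewrite -[x]scale1r; apply: sS.2. Qed.

Lemma subspaceZ c x : S x -> S (c *: x).
Proof. by move=> Sx; rewrite -[_ *: _]addr0; apply: sS.2 => //; case: sS. Qed.

Lemma subspaceN x : S x -> S (- x).
Proof. by move=> Sx; rewrite -scaleN1r; apply: subspaceZ. Qed.

Lemma subspaceB x y : S x -> S y -> S (x - y).
Proof. by move=> Sx Sy; apply: subspaceD => //; apply: subspaceN. Qed.

Lemma subspaceDr x y : S y -> S (x + y) -> S x.
Proof. by move=> Sy Sxy; rewrite -[x](addrK y); apply: subspaceB. Qed.

Lemma closure_subspace : linear_subspace (closure S).
Proof.
split; first exact/subset_closure/subspace0.
move=> c x y /closure_nrm clx /closure_nrm cly; apply/closure_nrm => e e0.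
set k := complex.Re `|c|.
have k0 : 0 <= k by exact: Re_norm_ge0.
have k1 : 0 < k + 1 by rewrite ltr_wpDl.
have [x' Sx' xx'] := clx _ (divr_gt0 (divr_gt0 e0 (ltr0Sn R 1)) k1).
have [y' Sy' yy'] := cly _ (divr_gt0 e0 (ltr0Sn R 1)).
exists (c *: x' + y'); first exact: sS.2.
rewrite opprD addrACA -scalerBr (le_lt_trans (nrmD _ _))// nrmZ -/k.
rewrite (splitr e) ler_ltD// (@le_trans _ _ ((k + 1) * nrm (x - x')))//.
  by rewrite ler_wpM2r ?nrm_ge0 ?lerDl.
by rewrite mulrC -ler_pdivlMr// ltW.
Qed.

End Subspace.

Lemma linear_span_subspace S : linear_subspace (linear_span S).
Proof.
split=> [|c x y Sx Sy] V [sV SV]; first by case: sV.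
by apply: sV.2; [apply: Sx|apply: Sy].
Qed.

Lemma linear_span_ind S (V : set A) : linear_subspace V ->
  S `<=` V -> linear_span S `<=` V.
Proof. by move=> sV SV x; apply. Qed.

Lemma commspan_subspace X Y : linear_subspace (commspan X Y).
Proof. exact: linear_span_subspace. Qed.

Lemma commspan_mem X Y x y : X x -> Y y -> commspan X Y (commutator x y).
Proof. by move=> Xx Yy V [_]; apply; exists x => //; exists y. Qed.

Lemma commspan_ind X Y (V : set A) : linear_subspace V ->
  (forall x y, X x -> Y y -> V (commutator x y)) -> commspan X Y `<=` V.
Proof.
by move=> sV XYV; apply: linear_span_ind => // _ [x Xx [y Yy <-]]; exact: XYV.
Qed.

Lemma closure_sub S V : closed V -> S `<=` V -> closure S `<=` V.
Proof. by move=> cV SV x /(closure_subset SV); apply: cV. Qed.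

End Norm.

(** * Closed ideals with quasi-central approximate identities *)

Section BanachIdeals.
Context {R : realType} {A : banachAlgType R}.
Implicit Types (x y z a b u v w : A) (S I J M L : set A) (c : R[i]) (e : R).

Lemma qcai_nrm I : admits_qcai I ->
  exists (T : Type) (le : T -> T -> Prop) (u : T -> A) (B : R),
    [/\ directed le, forall l, I (u l), forall l, nrm (u l) <= B,
        forall x e, I x -> 0 < e -> exists l0, forall l, le l0 l ->
          nrm (x ** u l - x) < e /\ nrm (u l ** x - x) < e &
        forall a e, 0 < e -> exists l0, forall l, le l0 l ->
          nrm (u l ** a - a ** u l) < e].
Proof.
move=> [T [le [u [dir Iu [B uB] uI ua]]]].
have [_ _ _ dd] := dir; exists T, le, u, (complex.Re B).
have evt (f : T -> A) e : 0 < e ->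
    `|f l| @[l --> net_tails le] --> (0 : R[i]^o) ->
    exists l0, forall l, le l0 l -> nrm (f l) < e.
  move=> e0 fl.
  have /fl[l0 hl0] : nbhs (0 : R[i]^o) (ball (0 : R[i]^o) e%:C).
    by apply: nbhsx_ballx; rewrite ltcR.
  exists l0 => l /hl0.
  by rewrite /= -ball_normE /= sub0r normrN normr_id nrm_lt.
split=> // [l|x e Ix e0|a e e0].
(* A complex number above a real one in the order of [R[i]] is itself real, so [complex.Re B] is
   still a bound. *)
- have := uB l; rewrite nrmE => h.
  have B0 : 0 <= B by rewrite (le_trans _ h)// lecR nrm_ge0.
  by rewrite -lecR (RRe_real (ger0_real B0)).
- have [/evt h1 /evt h2] := uI x Ix.
  have [[l1 hl1] [l2 hl2]] := (h1 _ e0, h2 _ e0).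
  have [n [l1n l2n]] := dd l1 l2.
  have [_ _ tr _] := dir.
  exists n => l nl; split; [apply: hl1|apply: hl2]; exact: tr nl.
- exact: evt e0 (ua a).
Qed.

Lemma qcai_units I x y e : admits_qcai I -> I x -> I y -> 0 < e ->
  exists u, [/\ I u, nrm (x ** u - x) < e & nrm (u ** y - y) < e].
Proof.
move=> /qcai_nrm[T [le [u [B [[_ _ _ dd] Iu _ uI _]]]]] Ix Iy e0.
have [l1 hl1] := uI _ _ Ix e0; have [l2 hl2] := uI _ _ Iy e0.
have [n [l1n l2n]] := dd l1 l2.
by exists (u n); split=> //; [case: (hl1 n)|case: (hl2 n)].
Qed.

Lemma closed_idealT : closed_ideal [set: A].
Proof. by do !split; exact: closedT. Qed.

Section Ideal.
Variables (I : set A) (cI : closed_ideal I).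

Lemma ideal_subspace : linear_subspace I.
Proof. by case: cI => -[]. Qed.

Let sI := ideal_subspace.

Lemma ideal_mulr x a : I x -> I (x ** a).
Proof. by case: cI => -[_ + _] => /(_ a x) h /h[]. Qed.

Lemma ideal_mull a x : I x -> I (a ** x).
Proof. by case: cI => -[_ + _] => /(_ a x) h /h[]. Qed.

Lemma ideal_commutator x a : I x -> I (commutator x a).
Proof.
by move=> Ix; apply: subspaceB => //; [exact: ideal_mulr|exact: ideal_mull].
Qed.

Lemma commspan_ideal S : commspan I S `<=` I.
Proof. by apply: commspan_ind => // x y Ix _; exact: ideal_commutator. Qed.

Lemma closure_commspan_ideal S : closure (commspan I S) `<=` I.
Proof. by apply: closure_sub; [case: cI|exact: commspan_ideal]. Qed.


(** For a unit [u] of [I] the element [a ** u] is in [I], and [commutator x (a ** u)] is close to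
    [commutator x a] once [x ** a ** u] is close to [x ** a] and [u ** x] to [x]. *)
Lemma commutator_ideal_closure x a :
  admits_qcai I -> I x -> closure (commspan I I) (commutator x a).
Proof.
move=> qI Ix; apply/closure_nrm => e e0.
have k0 : 0 < 1 + nrm a by rewrite ltr_pwDl ?nrm_ge0.
have [u [Iu h1 h2]] :=
  qcai_units qI (ideal_mulr a Ix) Ix (divr_gt0 e0 k0).
exists (commutator x (a ** u)).
  by apply: commspan_mem => //; exact: ideal_mull.
rewrite nrmB.
have -> : commutator x (a ** u) - commutator x a =
    (x ** a ** u - x ** a) - a ** (u ** x - x).
  by rewrite /commutator bmulBr !bmulA opprD addrACA -opprD.
rewrite (le_lt_trans (nrmD _ _))// nrmN.
rewrite (@lt_le_trans _ _ (e / (1 + nrm a) + nrm a * (e / (1 + nrm a))))//.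
  rewrite ltr_leD// (le_trans (nrmM _ _))// ler_wpM2l ?nrm_ge0// ltW//.
by rewrite -[X in X + _]mul1r -mulrDl mulrC divfK// gt_eqF.
Qed.

Lemma ideal_closure_commspan :
  admits_qcai I -> I `&` closure (commspan setT setT) `<=` closure (commspan I setT).
Proof.
move=> /qcai_nrm[T [le [u [B [[[l00] refl tr dd] Iu uB uI ua]]]]].
(* Elements that the approximate identity eventually multiplies close to the span of commutators.
   Being a subspace, [V] contains all sums of commutators as soon as it contains each commutator. *)
pose V : set A := [set y | forall e, 0 < e -> exists l0, forall l, le l0 l ->
  exists2 z, commspan I setT z & nrm (y ** u l - z) < e].
have sV : linear_subspace V.
  split=> [e e0|c x y Vx Vy e e0].
    exists l00 => l _; exists 0; last by rewrite bmul0l subrr nrm0.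
    by apply: subspace0; exact: commspan_subspace.
  set k := complex.Re `|c|; have k0 : 0 <= k := Re_norm_ge0 c.
  have k1 : 0 < k + 1 by rewrite ltr_wpDl.
  have [l1 hl1] := Vx _ (divr_gt0 (divr_gt0 e0 (ltr0Sn R 1)) k1).
  have [l2 hl2] := Vy _ (divr_gt0 e0 (ltr0Sn R 1)).
  have [n [l1n l2n]] := dd l1 l2.
  exists n => l nl.
  have [x' Sx' xx'] := hl1 l (tr _ _ _ l1n nl).
  have [y' Sy' yy'] := hl2 l (tr _ _ _ l2n nl).
  exists (c *: x' + y'); first exact: (commspan_subspace _ _).2.
  rewrite bmulDl bscalerAl opprD addrACA -scalerBr (le_lt_trans (nrmD _ _))//.
  rewrite nrmZ -/k (splitr e) ler_ltD//.
  rewrite (@le_trans _ _ ((k + 1) * nrm (x ** u l - x')))//.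
    by rewrite ler_wpM2r ?nrm_ge0 ?lerDl.
  by rewrite mulrC -ler_pdivlMr// ltW.
have VA : commspan setT setT `<=` V.
  apply: commspan_ind => // a b _ _ e e0.
  have k0 : 0 < 1 + nrm b by rewrite ltr_pwDl ?nrm_ge0.
  have [l0 hl0] := ua a _ (divr_gt0 e0 k0).
  exists l0 => l l0l; exists (commutator a (b ** u l)).
    rewrite commutatorN; apply: (subspaceN (commspan_subspace _ _)).
    by apply: commspan_mem => //; exact: ideal_mull.
  (* Quasi-centrality enters here: the error is [b] times the commutator of [u l] and [a]. *)
  have -> : commutator a b ** u l - commutator a (b ** u l) =
      b ** (u l ** a - a ** u l).
    by rewrite /commutator bmulBl bmulBr !bmulA opprB addrC addrA subrK.
  rewrite (le_lt_trans (nrmM _ _))//.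
  rewrite (@le_lt_trans _ _ (nrm b * (e / (1 + nrm b))))//.
    by rewrite ler_wpM2l ?nrm_ge0// ltW// hl0.
  by rewrite mulrCA gtr_pMr// ltr_pdivrMr// mul1r ltrDr.
move=> x [Ix /closure_nrm clx]; apply/closure_nrm => e e0.
have B0 : 0 <= B by rewrite (le_trans (nrm_ge0 (u l00))).
have B1 : 0 < B + 1 by rewrite ltr_wpDl.
have e3 : 0 < e / 3 by rewrite divr_gt0.
(* The chain is [x], [x ** u n], [y ** u n], [z]. Its middle link costs a factor [B], whence the
   tolerance; [B + 1] is positive even if [B] is zero. *)
have [y Ay xy] := clx _ (divr_gt0 e3 B1).
have [l1 hl1] := VA _ Ay _ e3.
have [l2 hl2] := uI _ _ Ix e3.
have [n [l1n l2n]] := dd l1 l2.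
have [z Iz yz] := hl1 _ l1n.
have [xu _] := hl2 _ l2n.
exists z => //.
rewrite (le_lt_trans (nrm_dist _ (x ** u n) _))//.
have -> : e = e / 3 + (e / 3 + e / 3) by field.
rewrite ltrD//; first by rewrite nrmB.
rewrite (le_lt_trans (nrm_dist _ (y ** u n) _))// ler_ltD//.
rewrite -bmulBl (le_trans (nrmM _ _))//.
rewrite (@le_trans _ _ (nrm (x - y) * (B + 1)))//.
  by rewrite ler_wpM2l ?nrm_ge0// (le_trans (uB n))// lerDl.
by rewrite -ler_pdivlMr// ltW.
Qed.

End Ideal.

Lemma closed_preimage S (f : A -> A) (k : R) : closed S ->
  (forall x y, nrm (f x - f y) <= k * nrm (x - y)) -> closed (f @^-1` S).
Proof.
move=> cS fk x /closure_nrm clx; apply: (closedP cS) => e e0.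
have k1 : 0 < `|k| + 1 by rewrite ltr_wpDl.
have [y Sy xy] := clx _ (divr_gt0 e0 k1).
exists (f y) => //; rewrite (le_lt_trans (fk _ _))//.
rewrite (@le_lt_trans _ _ ((`|k| + 1) * nrm (x - y)))//.
  by rewrite ler_wpM2r ?nrm_ge0// (le_trans (ler_norm k))// lerDl.
by rewrite mulrC -ltr_pdivlMr.
Qed.

Lemma closed_mulr S a : closed S -> closed [set x | S (x ** a)].
Proof.
move=> cS; apply: (closed_preimage (f := fun x => x ** a) (k := nrm a)) => //.
by move=> x y; rewrite -bmulBl mulrC nrmM.
Qed.

Lemma closed_mull S a : closed S -> closed [set x | S (a ** x)].
Proof.
move=> cS; apply: (closed_preimage (f := fun x => a ** x) (k := nrm a)) => //.
by move=> x y; rewrite -bmulBr nrmM.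
Qed.

Lemma closed_commutator S a : closed S -> closed [set x | S (commutator x a)].
Proof.
move=> cS.
apply: (closed_preimage (f := fun x => commutator x a) (k := 2 * nrm a)) => //.
by move=> x y; rewrite -commutatorBl (le_trans (nrm_commutator _ _))// mulrAC.
Qed.

(** Substitute for a factorization of [x] in [I]: [x] is a limit of the products [x ** u]. *)
Lemma qcai_factor I S x : admits_qcai I -> closed S -> I x ->
  (forall u, I u -> S (x ** u)) -> S x.
Proof.
move=> qI cS Ix h; apply: closedP => // e e0.
have [u [Iu xu _]] := qcai_units qI Ix Ix e0.
by exists (x ** u); [exact: h|rewrite nrmB].
Qed.

(** * Semiprimeness and inner derivations modulo a closed ideal *)

Section QCAI.
Hypothesis qcai : forall J, closed_ideal J -> admits_qcai J.

(** The closed ideal [T] of all y with x A y in [M] contains [x], hence every [x ** u]. Units v of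
    [T] give x u = lim x u v with x u v in [M], and units u of [A] give x = lim x u. *)
Lemma closed_ideal_semiprime M x : closed_ideal M ->
  (forall a, M (x ** a ** x)) -> M x.
Proof.
move=> cM xM; have [_ clM] := cM; have sM := ideal_subspace cM.
pose T : set A := [set y | forall a, M (x ** a ** y)].
have cT : closed_ideal T.
  split; [split; [split|]|].
  - by move=> a; rewrite bmul0r; exact: subspace0.
  - by move=> c y z Ty Tz a; rewrite bmulDr bscalerAr; apply: sM.2.
  - move=> b y Ty; split=> a; last by rewrite bmulA; exact: ideal_mulr.
    by rewrite bmulA -(bmulA x); exact: Ty.
  - rewrite (_ : T = \bigcap_a [set y | M (x ** a ** y)]).
      by apply: closed_bigI => a _; exact: closed_mull.
    by apply/seteqP; split=> y; [move=> Ty a _; exact: Ty|move=> Ty a; exact: Ty].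
apply: (qcai_factor (qcai closed_idealT)) => // u _.
apply: (qcai_factor (qcai cT) clM) => [|v Tv]; last exact: Tv.
exact: (ideal_mulr cT).
Qed.

(** Let d be the derivation [commutator x]. Modulo [M], Leibniz's rule for d (d (z w)) leaves 2 (d
    z) (d w), so (d z) (d w) = 0; putting w t for w gives (d z) w (d t) = 0, and semiprimeness
    applies to d y. *)
Lemma commutator_sq0 I M x : closed_ideal I -> closed_ideal M ->
  (forall y, I y -> M (commutator x (commutator x y))) ->
  forall y, I y -> M (commutator x y).
Proof.
move=> cI cM d2 y Iy; have [_ clM] := cM; have sM := ideal_subspace cM.
pose d := commutator x.
have Id z : I z -> I (d z).
  move=> Iz; rewrite /d commutatorN; apply: subspaceN.
    exact: ideal_subspace.
  exact: ideal_commutator.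
have dd z w : I z -> I w -> M (d z ** d w).
  move=> Iz Iw.
  have := d2 _ (ideal_mulr cI w Iz).
  rewrite commutator_mulr commutatorDr !commutator_mulr -/d -addrA.
  rewrite [X in _ + X]addrA => h.
  have /(subspaceZ sM 2^-1) : M (d z ** d w + d z ** d w).
    apply: (subspaceDr sM (y := z ** d (d w))).
      by apply: (ideal_mull cM); exact: d2.
    apply: (subspaceDr sM (y := d (d z) ** w)).
      by apply: (ideal_mulr cM); exact: d2.
    by rewrite addrC.
  rewrite -mulr2n -[X in 2^-1 *: X]scaler_nat scalerA mulVf ?scale1r//.
  by rewrite pnatr_eq0.
have dwd z w t : I z -> I w -> I t -> M (d z ** w ** d t).
  move=> Iz Iw It; have := dd _ _ Iz (ideal_mulr cI t Iw).
  rewrite /d commutator_mulr bmulDr -/d !bmulA addrC; apply: (subspaceDr sM).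
  by apply: (ideal_mulr cM); exact: dd.
(* The middle factor [a] need not lie in [I]: replacing the first [d y] by [d y ** u] with [u] in
   [I] turns it into [u ** a], which does. *)
apply: closed_ideal_semiprime => // a; rewrite -bmulA.
apply: (@qcai_factor I [set u | M (u ** (a ** d y))]) => //.
- exact: qcai.
- exact: closed_mulr.
- exact: Id.
move=> u Iu /=; rewrite bmulA -(bmulA (d y)).
by apply: dwd => //; exact: ideal_mulr.
Qed.

End QCAI.

(** * Lie ideals and the ideal attached to them *)

Section LieIdeal.
Variable L : set A.
Hypotheses (sL : linear_subspace L) (clL : closed L).
Hypothesis lieL : forall x a, L x -> L (commutator x a).

Let N : set A := [set x | forall b, L (commutator x b)].

Let sN : linear_subspace N.
Proof.
split=> [b|c x y Nx Ny b]; first by rewrite commutator0l; exact: subspace0.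
by rewrite commutatorDl commutatorZl; apply: sL.2.
Qed.

Let LN : L `<=` N. Proof. by move=> x Lx b; exact: lieL. Qed.

Let NM x y : N x -> N y -> N (x ** y).
Proof.
move=> Nx Ny b.
have -> : commutator (x ** y) b = commutator x (y ** b) + commutator y (b ** x).
  by rewrite /commutator !bmulA addrA subrK.
exact: subspaceD.
Qed.

(* An ideal: [N] contains [L] and is a subspace, so that [x a] in [N] for all [a]
   yields [b x a = [b, x a] + x a b] in [N]. *)
Definition lie_core : set A := [set x | forall a, N (x ** a)].

Lemma lie_core_closed_ideal : closed_ideal lie_core.
Proof.
split; [split; [split|]|].
- by move=> a; rewrite bmul0l; exact: subspace0.
- by move=> c x y Jx Jy a; rewrite bmulDl bscalerAl; apply: sN.2.
- move=> b x Jx; split=> a; last by rewrite -bmulA; exact: Jx.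
  rewrite -bmulA -[b ** _](subrK (x ** a ** b)) -/(commutator b (x ** a)).
  apply: (subspaceD sN); last by rewrite -bmulA; exact: Jx.
  by apply: LN; rewrite commutatorN; apply: (subspaceN sL); exact: Jx.
- rewrite (_ : lie_core = \bigcap_a \bigcap_b [set x | L (commutator (x ** a) b)]).
    apply: closed_bigI => a _; apply: closed_bigI => b _.
    apply: (@closed_mulr [set x | L (commutator x b)]).
    exact: closed_commutator.
  by apply/seteqP; split=> x Jx; [move=> a _ b _; exact: Jx|move=> a b; exact: Jx].
Qed.

Lemma lie_core_commutator u v : L u -> L v -> lie_core (commutator u v).
Proof.
move=> Lu Lv a.
have -> : commutator u v ** a = commutator u (v ** a) - v ** commutator u a.
  by rewrite commutator_mulr addrK.
apply: (subspaceB sN); first exact/LN/lieL.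
by apply: NM; apply: LN => //; exact: lieL.
Qed.

(** The elements [x ** u] are in [N] by definition of the core, and [x] is their limit when [u] runs
    through units of the core: the core is contained in [N]. *)
Lemma lie_core_closure x :
  admits_qcai lie_core -> lie_core x -> forall a, L (commutator x a).
Proof.
move=> qJ Jx a.
apply: (@qcai_factor lie_core [set x | L (commutator x a)]) => //.
  exact: closed_commutator.
by move=> u _; exact: Jx.
Qed.

End LieIdeal.

Section Main.
Hypothesis qcai : forall J, closed_ideal J -> admits_qcai J.
Variables (I : set A) (cI : closed_ideal I).

Let L := closure (commspan I (commspan I setT)).

Let sL : linear_subspace L.
Proof. exact/closure_subspace/commspan_subspace. Qed.

Let lieL x a : L x -> L (commutator x a).
Proof.
have cL : closed [set x | L (commutator x a)].
  by apply: closed_commutator; exact: closed_closure.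
move: x; apply: closure_sub => //; apply: commspan_ind.
  split=> [|c x y Lx Ly] /=; first by rewrite commutator0l; exact: subspace0.
  by rewrite commutatorDl commutatorZl; apply: sL.2.
(* Jacobi's identity distributes [a] over the two entries: the first stays in the ideal [I], the
   second in [I,A] by another use of the identity. *)
move=> x y Ix Iy /=; rewrite commutatorN; apply: (subspaceN sL).
apply: subset_closure; rewrite commutator_jacobi.
have sLL := commspan_subspace I (commspan I setT).
apply: (subspaceD sLL); apply: commspan_mem => //.
  rewrite commutatorN; apply: (subspaceN (ideal_subspace cI)).
  exact: ideal_commutator.
move: y Iy; apply: commspan_ind.
  have sIA := commspan_subspace I [set: A].
  split=> [|c z w Lz Lw] /=; first by rewrite commutator0r; exact: subspace0.
  by rewrite commutatorDr commutatorZr; apply: sIA.2.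
move=> z w Iz _ /=; rewrite commutator_jacobi.
apply: (subspaceD (commspan_subspace _ _)).
  apply: commspan_mem => //.
  rewrite commutatorN; apply: (subspaceN (ideal_subspace cI)).
  exact: ideal_commutator.
exact: commspan_mem.
Qed.

Let M := lie_core L.

Let cM : closed_ideal M.
Proof. apply: lie_core_closed_ideal => //; exact: closed_closure. Qed.

(* Modulo [M] the Lie ideal [L] is commutative, hence central as [A / M] is
   semiprime; then [c = [x, [x, y]]] and [c x = [x, [x, y x]]] are central for
   [x, y] in [I], so that [c ^ 2 = [x, [c x, y]] = 0] and thus [c = 0]. *)
Let commutator_lie_core x y : I x -> I y -> M (commutator x y).
Proof.
move=> Ix Iy; have sM := ideal_subspace cM; have sI := ideal_subspace cI.
have central u a : L u -> M (commutator u a).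
  move=> Lu; apply: (commutator_sq0 qcai closed_idealT cM) => // b _.
  by apply: lie_core_commutator => //; exact: lieL.
apply: (commutator_sq0 qcai cI cM) => // {}y {}Iy.
have LI z : I z -> L (commutator x (commutator x z)).
  move=> Iz; apply: subset_closure; apply: commspan_mem => //.
  exact: commspan_mem.
set c := commutator x (commutator x y).
have cx : L (c ** x).
  have := LI _ (ideal_mulr cI x Iy).
  have xx : commutator x x = 0 by rewrite /commutator subrr.
  by rewrite commutator_mulr xx bmul0r addr0 commutator_mulr xx bmul0r addr0.
have cc : M (c ** c).
  have : M (commutator x (c ** commutator x y)).
    rewrite commutatorN; apply: (subspaceN sM); apply: (ideal_commutator cM).
    apply: (subspaceDr sM (y := commutator c y ** x)).
      by apply: (ideal_mulr cM); apply: central; exact: LI.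
    by rewrite addrC -commutator_mull; exact: central.
  rewrite commutator_mulr addrC; apply: (subspaceDr sM).
  apply: (ideal_mulr cM); rewrite commutatorN; apply: (subspaceN sM).
  by apply: central; exact: LI.
apply: (closed_ideal_semiprime qcai) => // a.
rewrite -bmulA -[a ** c](subrK (c ** a)) -/(commutator a c) bmulDr.
apply: (subspaceD sM).
  apply: (ideal_mull cM); rewrite commutatorN; apply: (subspaceN sM).
  by apply: central; exact: LI.
by rewrite bmulA; exact: (ideal_mulr cM).
Qed.

Lemma closure_commspan_sub :
  closure (commspan I setT) `<=` closure (commspan I (commspan I setT)).
Proof.
have clM : closed M by case: cM.
have IAM : closure (commspan I setT) `<=` M.
  apply: closure_sub => //; apply: commspan_ind => [|x a Ix _].
    exact: (ideal_subspace cM).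
  have /commutator_ideal_closure : closed_ideal I by [].
  move=> /(_ x a (qcai cI) Ix); apply: closure_sub => //.
  by apply: commspan_ind => [|? ? ? ?];
    [exact: (ideal_subspace cM)|exact: commutator_lie_core].
move=> x IAx.
have := IAM _ IAx.
have MA := ideal_closure_commspan cM (qcai cM).
have : closure (commspan M setT) `<=` L.
  apply: closure_sub; first exact: closed_closure.
  apply: commspan_ind => // y a My _; apply: lie_core_closure => //.
    exact: closed_closure.
  exact: qcai.
move=> /(_ x) h Mx; apply: h; apply: MA; split => //.
apply: closure_subset IAx; apply: commspan_ind => [|y a _ _].
  exact: commspan_subspace.
exact: commspan_mem.
Qed.

Lemma closure_commspan_self :
  closure (commspan I I) = closure (commspan I setT).
Proof.
apply/seteqP; split.
  apply: closure_subset; apply: commspan_ind => [|y a Iy _].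
    exact: commspan_subspace.
  exact: commspan_mem.
apply: closure_sub; first exact: closed_closure.
apply: commspan_ind => [|x a Ix _]; first exact/closure_subspace/commspan_subspace.
by apply: commutator_ideal_closure => //; exact: qcai.
Qed.

Lemma closure_commspan_commspan :
  closure (commspan I setT) = closure (commspan I (commspan I setT)).
Proof.
apply/seteqP; split; first exact: closure_commspan_sub.
apply: closure_subset; apply: commspan_ind => [|y a Iy _].
  exact: commspan_subspace.
exact: commspan_mem.
Qed.

Lemma closure_commspan_cap :
  closure (commspan I setT) = I `&` closure (commspan setT setT).
Proof.
apply/seteqP; split; last by apply: ideal_closure_commspan => //; exact: qcai.
move=> x IAx; split; first exact: closure_commspan_ideal IAx.
apply: closure_subset IAx; apply: commspan_ind => [|y a _ _].
  exact: commspan_subspace.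
exact: commspan_mem.
Qed.

End Main.
End BanachIdeals.

(** * The multiplier algebra *)

Section CstarNorm.
Context {R : realType} {A : cstarAlgType R}.
Implicit Types (x y z : A) (c : R[i]) (r : R).

Lemma nrm_cstar x : nrm (star x ** x) = nrm x ^+ 2.
Proof. by apply: (@complexI R); rewrite -nrmE normrCstar nrmE expr2 rcM. Qed.

Lemma nrm_star x : nrm (star x) = nrm x.
Proof.
have le z : nrm z <= nrm (star z).
  have [->|z0] := eqVneq z 0; first by rewrite nrm0 nrm_ge0.
  have zp : 0 < nrm z.
    by rewrite lt_neqAle nrm_ge0 andbT eq_sym; apply: contra_neq z0 => /nrm_eq0.
  by rewrite -(ler_pM2r zp) -expr2 -nrm_cstar nrmM.
by apply/le_anti; rewrite le -[X in nrm (star x) <= nrm X]starK le.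
Qed.

Lemma starN x : star (- x) = - star x.
Proof. by rewrite -scaleN1r starZ rmorphN rmorph1 scaleN1r. Qed.

Lemma starB x y : star (x - y) = star x - star y.
Proof. by rewrite starD starN. Qed.

Lemma starZr r x : star (r%:C *: x) = r%:C *: star x.
Proof. by rewrite starZ conj_Creal// complex_real. Qed.

Lemma star_mul_eq0 x : star x ** x = 0 -> x = 0.
Proof.
move=> h; apply: nrm_eq0; apply/eqP; rewrite -sqrf_eq0 -nrm_cstar h.
by rewrite nrm0.
Qed.

Lemma star_mull_inj x y : (forall z, star z ** x = star z ** y) -> x = y.
Proof.
move=> h; apply/eqP; rewrite -subr_eq0; apply/eqP/star_mul_eq0.
by rewrite bmulBr h subrr.
Qed.

Lemma mulr_inj x y : (forall z, x ** z = y ** z) -> x = y.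
Proof.
move=> h; rewrite -[x]starK -[y]starK; congr star; apply: star_mull_inj => z.
by rewrite -!starM h.
Qed.

End CstarNorm.

(* The adjointable operators on [A], seen as a Hilbert module over itself, form
   a unital C*-algebra containing [A]; it replaces the unitization of [A]. *)
Record multiplier (R : realType) (A : cstarAlgType R) := Multiplier {
  mfun :> A -> A;
  madj : A -> A;
  madjP : forall x y, star (mfun x) ** y = star x ** madj y;
  mboundedP : exists2 c : R, 0 <= c & forall x, nrm (mfun x) <= c * nrm x }.

Section Multiplier.
Context {R : realType} {A : cstarAlgType R}.
Implicit Types (x y z : A) (c : R[i]) (r t : R) (S T U : multiplier A).

Lemma multiplierP S T : S =1 T -> S = T.
Proof.
case: S T => [f f' adjf bf] [g g' adjg bg] /= fg.
have {}fg : f = g by apply/funext.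
have fg' : f' = g'.
  apply/funext => y; apply: star_mull_inj => z.
  by rewrite -adjf fg adjg.
by subst g g'; congr Multiplier; exact: Prop_irrelevance.
Qed.

(** Adjointability forces linearity, and commutation with right multiplications, because the pairing
    [star x ** y] is nondegenerate. *)
Lemma multD T x y : T (x + y) = T x + T y.
Proof.
rewrite -[LHS]starK -[RHS]starK; congr star; apply: mulr_inj => z.
by rewrite starD bmulDl !madjP starD bmulDl.
Qed.

Lemma multZ T c x : T (c *: x) = c *: T x.
Proof.
rewrite -[LHS]starK -[RHS]starK; congr star; apply: mulr_inj => z.
by rewrite !starZ bscalerAl !madjP starZ bscalerAl.
Qed.

Lemma multM T x y : T (x ** y) = T x ** y.
Proof.
rewrite -[LHS]starK -[RHS]starK; congr star; apply: mulr_inj => z.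
by rewrite starM madjP !starM -!bmulA madjP.
Qed.

Lemma madjP_sym T x y : star (madj T x) ** y = star x ** T y.
Proof. by rewrite -[LHS]starK starM starK -madjP starM starK. Qed.

(** The operator norm enters only through its upper bounds. *)
Definition bnd T r := forall x, nrm (T x) <= r * nrm x.

Lemma bnd_ex T : exists2 r, 0 < r & bnd T r.
Proof.
have [c c0 h] := mboundedP T; exists (c + 1); first by rewrite ltr_wpDl.
by move=> x; rewrite (le_trans (h x))// ler_wpM2r ?nrm_ge0 ?lerDl.
Qed.

(** A factor |T^* x| cancels in |T^* x|^2 = |x^* T T^* x| <= |x| r |T^* x|. *)
Lemma nrm_madj T r x : bnd T r -> nrm (madj T x) <= r * nrm x.
Proof.
move=> bT; have [h|h] := leP (nrm (madj T x)) 0.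
  have -> : madj T x = 0 by apply/nrm_eq0/le_anti; rewrite h nrm_ge0.
  by rewrite nrm0 (le_trans (nrm_ge0 (T x))).
rewrite -(ler_pM2l h) -expr2 -nrm_cstar madjP_sym mulrC.
rewrite (le_trans (nrmM _ _))// nrm_star.
by rewrite [leRHS]mulrAC mulrC ler_wpM2r ?nrm_ge0.
Qed.

Fact mult0_adj x y : star (0 : A) ** y = star x ** (0 : A).
Proof. by rewrite -[X in star X](subrr 0) starB subrr bmul0l bmul0r. Qed.

Fact mult0_bnd : exists2 c : R, 0 <= c & forall x, nrm (0 : A) <= c * nrm x.
Proof. by exists 0 => // x; rewrite nrm0 mul0r. Qed.

Definition mult_zero := Multiplier mult0_adj mult0_bnd.

Fact mult1_adj x y : star x ** y = star x ** y.
Proof. by []. Qed.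

Fact mult1_bnd : exists2 c : R, 0 <= c & forall x, nrm x <= c * nrm x.
Proof. by exists 1 => // x; rewrite mul1r. Qed.

Definition mult_one := Multiplier mult1_adj mult1_bnd.

Fact mult_add_adj S T x y :
  star (S x + T x) ** y = star x ** (madj S y + madj T y).
Proof. by rewrite starD bmulDl bmulDr !madjP. Qed.

Fact mult_add_bnd S T :
  exists2 c : R, 0 <= c & forall x, nrm (S x + T x) <= c * nrm x.
Proof.
have [[c c0 Sc] [d d0 Td]] := (mboundedP S, mboundedP T).
exists (c + d) => [|x]; first exact: addr_ge0.
by rewrite (le_trans (nrmD _ _))// mulrDl lerD.
Qed.

Definition mult_add S T :=
  Multiplier (mult_add_adj S T) (mult_add_bnd S T).

Fact mult_scale_adj c T x y :
  star (c *: T x) ** y = star x ** ((c^*)%R *: madj T y).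
Proof. by rewrite starZ bscalerAl bscalerAr madjP. Qed.

Fact mult_scale_bnd c T :
  exists2 d : R, 0 <= d & forall x, nrm (c *: T x) <= d * nrm x.
Proof.
have [d d0 Td] := mboundedP T.
exists (complex.Re `|c| * d) => [|x]; first by rewrite mulr_ge0 ?Re_norm_ge0.
by rewrite nrmZ -mulrA ler_wpM2l ?Re_norm_ge0.
Qed.

Definition mult_scale c T :=
  Multiplier (mult_scale_adj c T) (mult_scale_bnd c T).

Fact mult_mul_adj S T x y :
  star (S (T x)) ** y = star x ** madj T (madj S y).
Proof. by rewrite !madjP. Qed.

Fact mult_mul_bnd S T :
  exists2 c : R, 0 <= c & forall x, nrm (S (T x)) <= c * nrm x.
Proof.
have [[c c0 Sc] [d d0 Td]] := (mboundedP S, mboundedP T).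
exists (c * d) => [|x]; first exact: mulr_ge0.
by rewrite (le_trans (Sc _))// -mulrA ler_wpM2l.
Qed.

Definition mult_mul S T :=
  Multiplier (mult_mul_adj S T) (mult_mul_bnd S T).

Fact mstar_bnd T :
  exists2 c : R, 0 <= c & forall x, nrm (madj T x) <= c * nrm x.
Proof.
by have [c c0 Tc] := mboundedP T; exists c => // x; exact: nrm_madj.
Qed.

Definition mstar T := Multiplier (madjP_sym T) (mstar_bnd T).

Fact lmul_adj a x y : star (a ** x) ** y = star x ** (star a ** y).
Proof. by rewrite starM bmulA. Qed.

Fact lmul_bnd a :
  exists2 c : R, 0 <= c & forall x, nrm (a ** x) <= c * nrm x.
Proof. by exists (nrm a) => [|x]; rewrite ?nrm_ge0 ?nrmM. Qed.

Definition lmul a := Multiplier (lmul_adj a) (lmul_bnd a).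

HB.instance Definition _ := gen_eqMixin (multiplier A).
HB.instance Definition _ := gen_choiceMixin (multiplier A).

Fact mult_addA : associative mult_add.
Proof. by move=> S T U; apply: multiplierP => x /=; rewrite addrA. Qed.

Fact mult_addC : commutative mult_add.
Proof. by move=> S T; apply: multiplierP => x /=; rewrite addrC. Qed.

Fact mult_add0 : left_id mult_zero mult_add.
Proof. by move=> S; apply: multiplierP => x /=; rewrite add0r. Qed.

Fact mult_addN : left_inverse mult_zero (mult_scale (- 1)) mult_add.
Proof. by move=> S; apply: multiplierP => x /=; rewrite scaleN1r addNr. Qed.

HB.instance Definition _ := GRing.isZmodule.Build (multiplier A)
  mult_addA mult_addC mult_add0 mult_addN.

Fact mult_mulA : associative mult_mul.
Proof. by move=> S T U; exact: multiplierP. Qed.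

Fact mult_mul1l : left_id mult_one mult_mul.
Proof. by move=> S; exact: multiplierP. Qed.

Fact mult_mul1r : right_id mult_one mult_mul.
Proof. by move=> S; exact: multiplierP. Qed.

Fact mult_mulDl : left_distributive mult_mul +%R.
Proof. by move=> S T U; exact: multiplierP. Qed.

Fact mult_mulDr : right_distributive mult_mul +%R.
Proof. by move=> S T U; apply: multiplierP => x /=; rewrite multD. Qed.

(** A possibly zero ring, since [1 = 0] when [A] is zero. *)
HB.instance Definition _ := GRing.Zmodule_isPzRing.Build (multiplier A)
  mult_mulA mult_mul1l mult_mul1r mult_mulDl mult_mulDr.

Fact mult_scaleA c d T : mult_scale c (mult_scale d T) = mult_scale (c * d) T.
Proof. by apply: multiplierP => x /=; rewrite scalerA. Qed.

Fact mult_scale1 : left_id 1 mult_scale.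
Proof. by move=> T; apply: multiplierP => x /=; rewrite scale1r. Qed.

Fact mult_scaleDr : right_distributive mult_scale +%R.
Proof. by move=> c S T; apply: multiplierP => x /=; rewrite scalerDr. Qed.

Fact mult_scaleDl T : {morph mult_scale^~ T: c d / c + d}.
Proof. by move=> c d; apply: multiplierP => x /=; rewrite scalerDl. Qed.

HB.instance Definition _ := GRing.Zmodule_isLmodule.Build R[i] (multiplier A)
  mult_scaleA mult_scale1 mult_scaleDr mult_scaleDl.

Lemma mult_addE S T x : (S + T) x = S x + T x. Proof. by []. Qed.
Lemma mult_oppE T x : (- T) x = - T x. Proof. exact: scaleN1r. Qed.
Lemma mult_subE S T x : (S - T) x = S x - T x.
Proof. by rewrite mult_addE mult_oppE. Qed.
Lemma mult_mulE S T x : (S * T) x = S (T x). Proof. by []. Qed.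
Lemma mult_scaleE c T x : (c *: T) x = c *: T x. Proof. by []. Qed.

Lemma mscaleAl c S T : (c *: S) * T = c *: (S * T).
Proof. exact: multiplierP. Qed.

Lemma mscaleAr c S T : S * (c *: T) = c *: (S * T).
Proof. by apply: multiplierP => x; rewrite mult_mulE multZ. Qed.

Lemma mstarK : involutive mstar.
Proof. by move=> T; exact: multiplierP. Qed.

Lemma mstarD S T : mstar (S + T) = mstar S + mstar T.
Proof. exact: multiplierP. Qed.

Lemma mstarZ c T : mstar (c *: T) = (c^*)%R *: mstar T.
Proof. exact: multiplierP. Qed.

Lemma mstarZr r T : mstar (r%:C *: T) = r%:C *: mstar T.
Proof. by rewrite mstarZ conj_Creal// complex_real. Qed.

Lemma mstarN T : mstar (- T) = - mstar T.
Proof. by rewrite -scaleN1r mstarZ rmorphN rmorph1 scaleN1r. Qed.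

Lemma mstarB S T : mstar (S - T) = mstar S - mstar T.
Proof. by rewrite mstarD mstarN. Qed.

Lemma mstarM S T : mstar (S * T) = mstar T * mstar S.
Proof. exact: multiplierP. Qed.

Lemma mstar1 : mstar 1 = 1.
Proof. exact: multiplierP. Qed.

Lemma mstar0 : mstar 0 = 0.
Proof. exact: multiplierP. Qed.

Definition msc r : multiplier A := r%:C *: (1 : multiplier A).

Lemma mscl r T : msc r * T = r%:C *: T.
Proof. by rewrite mscaleAl mul1r. Qed.

Lemma mscr r T : T * msc r = r%:C *: T.
Proof. by rewrite mscaleAr mulr1. Qed.

Lemma mscD r t : msc (r + t) = msc r + msc t.
Proof. by rewrite /msc rcD scalerDl. Qed.

Lemma msc1 : msc 1 = 1.
Proof. exact: scale1r. Qed.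

Lemma msc0 : msc 0 = 0.
Proof. exact: scale0r. Qed.

Lemma mstar_msc r : mstar (msc r) = msc r.
Proof. by rewrite mstarZr mstar1. Qed.

Lemma lmulD a b : lmul (a + b) = lmul a + lmul b.
Proof. by apply: multiplierP => x /=; rewrite bmulDl. Qed.

Lemma lmulZ c a : lmul (c *: a) = c *: lmul a.
Proof. by apply: multiplierP => x /=; rewrite bscalerAl. Qed.

Lemma lmulN a : lmul (- a) = - lmul a.
Proof. by rewrite -scaleN1r lmulZ scaleN1r. Qed.

Lemma lmulB a b : lmul (a - b) = lmul a - lmul b.
Proof. by rewrite lmulD lmulN. Qed.

Lemma lmul0 : lmul 0 = 0.
Proof. by rewrite -(subrr 0) lmulB subrr. Qed.

Lemma lmulM a b : lmul (a ** b) = lmul a * lmul b.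
Proof. by apply: multiplierP => x /=; rewrite bmulA. Qed.

Lemma lmul_star a : lmul (star a) = mstar (lmul a).
Proof. exact: multiplierP. Qed.

Lemma lmul_inj : injective lmul.
Proof. by move=> a b ab; apply: mulr_inj => z; exact: (congr1 (fun T : multiplier A => T z) ab). Qed.

Lemma mult_lmul T a : T * lmul a = lmul (T a).
Proof. by apply: multiplierP => x; rewrite mult_mulE /= multM. Qed.

(** The product a T: multipliers act on the right of [A] through their adjoints. *)
Definition rmul a T : A := star (mstar T (star a)).

Lemma lmul_rmul a T : lmul (rmul a T) = lmul a * T.
Proof.
by rewrite /rmul lmul_star -mult_lmul mstarM mstarK lmul_star mstarK.
Qed.

Lemma bnd0 : bnd 0 0.
Proof. by move=> x; rewrite nrm0 mul0r. Qed.

Lemma bnd1 : bnd 1 1.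
Proof. by move=> x; rewrite mul1r. Qed.

Lemma bnd_le T r t : r <= t -> bnd T r -> bnd T t.
Proof. by move=> rt bT x; rewrite (le_trans (bT x))// ler_wpM2r ?nrm_ge0. Qed.

Lemma bndD S T r t : bnd S r -> bnd T t -> bnd (S + T) (r + t).
Proof. by move=> bS bT x; rewrite mulrDl (le_trans (nrmD _ _))// lerD. Qed.

Lemma bndN T r : bnd T r -> bnd (- T) r.
Proof. by move=> bT x; rewrite mult_oppE nrmN. Qed.

Lemma bndB S T r t : bnd S r -> bnd T t -> bnd (S - T) (r + t).
Proof. by move=> bS /bndN; exact: bndD. Qed.

Lemma bndC S T r : bnd (S - T) r -> bnd (T - S) r.
Proof. by move=> /bndN; rewrite opprB. Qed.

Lemma bndM S T r t : 0 <= r -> bnd S r -> bnd T t -> bnd (S * T) (r * t).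
Proof.
move=> r0 bS bT x; rewrite mult_mulE (le_trans (bS _))// -mulrA.
by rewrite ler_wpM2l.
Qed.

Lemma bndZ c T r : bnd T r -> bnd (c *: T) (complex.Re `|c| * r).
Proof. by move=> bT x; rewrite mult_scaleE nrmZ -mulrA ler_wpM2l ?Re_norm_ge0. Qed.

Lemma bndZr t T r : bnd T r -> bnd (t%:C *: T) (`|t| * r).
Proof. by move=> bT x; rewrite mult_scaleE nrmZr -mulrA ler_wpM2l. Qed.

Lemma bnd_msc t : bnd (msc t) `|t|.
Proof. by rewrite -[`|t|]mulr1; exact/bndZr/bnd1. Qed.

Lemma bnd_star T r : bnd T r -> bnd (mstar T) r.
Proof. by move=> bT x; exact: nrm_madj. Qed.

Lemma bnd_lmul a : bnd (lmul a) (nrm a).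
Proof. by move=> x; exact: nrmM. Qed.

(** Together with [bnd_lmul] this makes [lmul] isometric; the bound is tested at [star a]. *)
Lemma nrm_bnd a r : 0 <= r -> bnd (lmul a) r -> nrm a <= r.
Proof.
move=> r0 ba; rewrite leNgt; apply/negP => ra.
have a0 : 0 < nrm a by exact: le_lt_trans ra.
have : nrm a * nrm a <= r * nrm a.
  by rewrite -expr2 -(nrm_star a) -nrm_cstar starK; exact: ba.
by rewrite ler_pM2r// leNgt ra.
Qed.

Lemma bnd_cstar T r : 0 <= r -> bnd (mstar T * T) (r ^+ 2) -> bnd T r.
Proof.
move=> r0 bT x; rewrite -ler_sqr ?nnegrE ?mulr_ge0 ?nrm_ge0//.
rewrite -nrm_cstar madjP (le_trans (nrmM _ _))// nrm_star.
rewrite (le_trans (ler_wpM2l (nrm_ge0 x) (bT x)))//.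
by rewrite exprMn mulrCA -expr2.
Qed.

Lemma bnd_lim T r : (forall e, 0 < e -> bnd T (r + e)) -> bnd T r.
Proof.
move=> h x; apply/ler_addgt0Pr => e e0.
have k0 : 0 < nrm x + 1 by rewrite ltr_wpDl ?nrm_ge0.
rewrite (le_trans (h _ (divr_gt0 e0 k0) x))// mulrDl lerD2l.
by rewrite mulrAC ler_pdivrMr// ler_wpM2l ?(ltW e0)// lerDl.
Qed.

Lemma bnd_eq0 T : bnd T 0 -> T = 0.
Proof.
move=> h; apply: multiplierP => x; apply: nrm_eq0; apply/le_anti.
by rewrite nrm_ge0 andbT (le_trans (h x))// mul0r.
Qed.

Lemma sa_sqr_eq0 T : mstar T = T -> T * T = 0 -> T = 0.
Proof.
move=> sT TT; apply: bnd_eq0; apply: bnd_cstar => //.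
by rewrite sT TT expr0n; exact: bnd0.
Qed.

End Multiplier.

(** * Square roots *)

Section Completeness.
Context {R : realType}.

Lemma nrm_complete (A : banachAlgType R) (a : nat -> A) :
  (forall e : R, 0 < e -> exists N, forall m n, (N <= m)%N -> (N <= n)%N ->
     nrm (a m - a n) <= e) ->
  exists l, forall e : R, 0 < e -> exists N, forall n, (N <= n)%N ->
     nrm (a n - l) <= e.
Proof.
move=> ca; have /cauchy_cvgP/cvg_ex[l al] : cauchy (a n @[n --> \oo]).
  apply: cauchy_exP => e e0; have eE : e = (complex.Re e)%:C.
    by rewrite RRe_real// gtr0_real.
  move: e0; rewrite eE ltcR => e0.
  have [N hN] := ca _ (divr_gt0 e0 (ltr0Sn R 1)).
  exists (a N), N => // n /= Nn; rewrite -ball_normE /= nrm_lt.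
  rewrite (le_lt_trans (hN _ _ (leqnn N) Nn))//.
  by rewrite ltr_pdivrMr// ltr_pMr// ltr1n.
exists l => e e0.
have /cvgrPdist_le/(_ e%:C) [|N _ hN] := al; first by rewrite ltcR.
by exists N => n Nn; rewrite nrmB -nrm_le; exact: hN.
Qed.

Context {A : cstarAlgType R}.
Implicit Types (S T U X Y Z : multiplier A) (u v : nat -> multiplier A).
Implicit Types (x y z : A) (e r t : R).

Definition mconv u T := forall e, 0 < e ->
  exists N, forall n, (N <= n)%N -> bnd (u n - T) e.

Lemma mult_complete u :
  (forall e, 0 < e -> exists N, forall m n, (N <= m)%N -> (N <= n)%N ->
     bnd (u m - u n) e) ->
  exists T, mconv u T.
Proof.
move=> cu.
have cv (v : nat -> multiplier A) : (forall e, 0 < e -> exists N,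
    forall m n, (N <= m)%N -> (N <= n)%N -> bnd (v m - v n) e) ->
  {f : A -> A & forall x e, 0 < e -> exists N, forall n, (N <= n)%N ->
     nrm (v n x - f x) <= e}.
  move=> hv; apply: (@boolp.choice A A (fun x y => forall e, 0 < e -> exists N,
    forall n, (N <= n)%N -> nrm (v n x - y) <= e)) => x; apply: nrm_complete => e e0.
  have k0 : 0 < nrm x + 1 by rewrite ltr_wpDl ?nrm_ge0.
  have [N hN] := hv _ (divr_gt0 e0 k0).
  exists N => m n Nm Nn; rewrite -mult_subE (le_trans (hN _ _ Nm Nn x))//.
  by rewrite mulrAC ler_pdivrMr// ler_wpM2l ?(ltW e0)// lerDl.
have [f hf] := cv u cu.
(* The adjoints form a Cauchy sequence too, and their pointwise limit is the adjoint of [f]. *)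
have [|g hg] := cv (mstar \o u).
  move=> e /cu[N hN]; exists N => m n Nm Nn.
  by rewrite /= -mstarB; apply/bnd_star/hN.
have adj x y : star (f x) ** y = star x ** g y.
  apply/eqP; rewrite -subr_eq0; apply/eqP/nrm_eq0/le_anti.
  rewrite nrm_ge0 andbT; apply/ler_addgt0Pr => e e0; rewrite add0r.
  have k0 : 0 < nrm x + nrm y + 1.
    by rewrite ltr_wpDl// addr_ge0 ?nrm_ge0.
  have [N1 h1] := hf x _ (divr_gt0 e0 k0).
  have [N2 h2] := hg y _ (divr_gt0 e0 k0).
  have {h1} := h1 (maxn N1 N2) (leq_maxl _ _).
  have {h2} := h2 (maxn N1 N2) (leq_maxr _ _).
  set w := u _; rewrite /= -/w => h2 h1.
  have -> : star (f x) ** y - star x ** g y =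
      star x ** (madj w y - g y) - star (w x - f x) ** y.
    by rewrite starB bmulBr bmulBl madjP; linear_eq R[i] A; ring.
  rewrite (le_trans (nrmD _ _))// nrmN.
  rewrite (@le_trans _ _ ((nrm x + nrm y) * (e / (nrm x + nrm y + 1))))//.
    rewrite mulrDl lerD// (le_trans (nrmM _ _))// nrm_star.
      by rewrite ler_wpM2l ?nrm_ge0.
    by rewrite mulrC ler_wpM2l ?nrm_ge0.
  by rewrite mulrCA ger_pMr// ler_pdivrMr// mul1r lerDl.
have lim N r x y : (forall n, (N <= n)%N -> nrm (u n x - y) <= r) ->
    nrm (f x - y) <= r.
  move=> h; apply/ler_addgt0Pr => e e0.
  have [M hM] := hf x _ e0.
  rewrite (le_trans (nrm_dist _ (u (maxn M N) x) _))// addrC lerD//.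
    by rewrite h// leq_maxr.
  by rewrite nrmB hM// leq_maxl.
have bf : exists2 c : R, 0 <= c & forall x, nrm (f x) <= c * nrm x.
  have [N hN] := cu 1 ltr01; have [r r0 br] := bnd_ex (u N).
  exists (1 + r) => [|x]; first by rewrite addr_ge0 ?(ltW r0).
  rewrite -[f x]subr0; apply: (lim N) => n Nn; rewrite subr0.
  rewrite -[u n x](subrK (u N x)) (le_trans (nrmD _ _))// mulrDl lerD//.
  by rewrite -mult_subE; exact: hN.
exists (Multiplier adj bf) => e /cu[N hN]; exists N => n Nn x.
rewrite mult_subE nrmB /=; apply: (lim N) => m Nm.
by rewrite -mult_subE; exact: hN.
Qed.

(** Intertwining relations pass to limits; with [X = 1] this is also the uniqueness of limits. *)
Lemma mconv_eq u v S T X : mconv u S -> mconv v T ->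
  (forall n, u n * X = X * v n) -> S * X = X * T.
Proof.
move=> uS vT h; apply/eqP; rewrite -subr_eq0; apply/eqP/bnd_eq0.
apply: bnd_lim => e e0; rewrite add0r.
have [r r0 bX] := bnd_ex X.
have e'0 : 0 < e / 2 / r by rewrite !divr_gt0.
have [[N hN] [M hM]] := (uS _ e'0, vT _ e'0).
have {hN} := hN (maxn N M) (leq_maxl _ _).
have {hM} := hM (maxn N M) (leq_maxr _ _).
set n := maxn N M => /(bndM (ltW r0) bX) h1 /bndC/bndM/(_ bX) h2.
have -> : S * X - X * T = (S - u n) * X + X * (v n - T).
  by rewrite mulrBl mulrBr h addrA subrK.
have -> : e = e / 2 / r * r + r * (e / 2 / r).
  by rewrite [r * _]mulrC divfK ?gt_eqF// -splitr.
by apply: bndD => //; apply: h2; exact: ltW.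
Qed.

Lemma mconv_bnd u T r : mconv u T -> (forall n, bnd (u n) r) -> bnd T r.
Proof.
move=> uT ur; apply: bnd_lim => e /uT[N hN].
rewrite -[T](subrK (u N)) addrC; apply: bndD => //.
by apply: bndC; exact: hN.
Qed.

Lemma mconv_star u T : mconv u T -> mconv (fun n => mstar (u n)) (mstar T).
Proof.
move=> uT e /uT[N hN]; exists N => n Nn.
by rewrite -mstarB; apply: bnd_star; exact: hN.
Qed.

Definition mlim u := xget 0 [set T | mconv u T].

Lemma mlimP u :
  (forall e, 0 < e -> exists N, forall m n, (N <= m)%N -> (N <= n)%N ->
     bnd (u m - u n) e) -> mconv u (mlim u).
Proof. by move=> /mult_complete[T uT]; rewrite /mlim; apply: (xgetI 0 uT). Qed.

(* If [b = 1 - z] then [b ^ 2 = 1 - Y] means [z = (Y + z ^ 2) / 2]; for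
   [|Y| <= 1] the Picard iterates are dominated by those of [Y = 1]. *)
Definition sqrt_iter Y n := iter n (fun Z => 2^-1%:C *: (Y + Z * Z)) 0.

Definition sqrt_maj n : R := iter n (fun s => 2^-1 * (1 + s * s)) 0.

Lemma sqrt_maj_ge0 n : 0 <= sqrt_maj n.
Proof.
by elim: n => //= n ih; rewrite mulr_ge0 ?invr_ge0// addr_ge0// mulr_ge0.
Qed.

Lemma sqrt_maj_le1 n : sqrt_maj n <= 1.
Proof.
elim: n => [|n ih] /=; first exact: ler01.
have := sqrt_maj_ge0 n; set s := sqrt_maj n in ih *; nra.
Qed.

Lemma sqrt_majS n : sqrt_maj n <= sqrt_maj n.+1.
Proof.
rewrite [leRHS]/=; have := sqrt_maj_le1 n; set s := sqrt_maj n; nra.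
Qed.

Lemma sqrt_maj_mono : {homo sqrt_maj : m n / (m <= n)%N >-> m <= n}.
Proof. by apply: homo_leq => //; [exact: le_trans|exact: sqrt_majS]. Qed.

Lemma sqrt_iter_bnd Y n : bnd Y 1 -> bnd (sqrt_iter Y n) (sqrt_maj n).
Proof.
move=> bY; elim: n => [|n ih]; first exact: bnd0.
rewrite [sqrt_iter _ _]/= [sqrt_maj _]/=.
have h2 : 0 <= 2^-1 :> R by rewrite invr_ge0.
rewrite -[X in X * (_ + _)](ger0_norm h2) -/(sqrt_iter Y n) -/(sqrt_maj n).
apply: bndZr; apply: bndD => //; apply: bndM => //; exact: sqrt_maj_ge0.
Qed.

(** The splitting Z^2 - Z'^2 = Z (Z - Z') + (Z - Z') Z' holds without commutation. The same
    splitting for the scalars, whose increments are nonnegative, reproduces exactly the next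
    increment of [sqrt_maj]. *)
Lemma sqrt_iter_bndS Y n : bnd Y 1 ->
  bnd (sqrt_iter Y n.+1 - sqrt_iter Y n) (sqrt_maj n.+1 - sqrt_maj n).
Proof.
move=> bY; elim: n => [|n ih].
  by rewrite !subr0; exact: (sqrt_iter_bnd 1 bY).
set Z := sqrt_iter Y n.+1 in ih *; set Z' := sqrt_iter Y n in ih *.
have -> : sqrt_iter Y n.+2 - Z = 2^-1%:C *: (Z * (Z - Z') + (Z - Z') * Z').
  rewrite mulrBr mulrBl addrA subrK -[sqrt_iter Y n.+2]/(_ *: (Y + Z * Z)).
  rewrite -[X in _ - X = _]/(2^-1%:C *: (Y + Z' * Z')).
  by rewrite -scalerBr opprD addrACA subrr add0r.
set s := sqrt_maj n.+1 in ih *; set s' := sqrt_maj n in ih *.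
have -> : sqrt_maj n.+2 - s = `|2^-1| * (s * (s - s') + (s - s') * s').
  have sE : s = 2^-1 * (1 + s' * s') by [].
  rewrite ger0_norm ?invr_ge0// -[X in X - _]/(2^-1 * (1 + s * s)).
  rewrite [X in _ * _ - X]sE; ring.
have ss' : 0 <= s - s' by rewrite subr_ge0 sqrt_majS.
by apply/bndZr/bndD; apply: bndM => //;
  by [exact: sqrt_maj_ge0|exact: sqrt_iter_bnd].
Qed.

Lemma sqrt_iter_cauchy Y m n : bnd Y 1 -> (m <= n)%N ->
  bnd (sqrt_iter Y n - sqrt_iter Y m) (sqrt_maj n - sqrt_maj m).
Proof.
move=> bY /subnK <-; elim: (n - m)%N => [|k ih].
  by rewrite add0n !subrr; exact: bnd0.
have -> : sqrt_iter Y (k.+1 + m) - sqrt_iter Y m =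
    (sqrt_iter Y (k + m).+1 - sqrt_iter Y (k + m)) +
    (sqrt_iter Y (k + m) - sqrt_iter Y m) by rewrite addrA subrK.
have -> : sqrt_maj (k.+1 + m) - sqrt_maj m =
    (sqrt_maj (k + m).+1 - sqrt_maj (k + m)) +
    (sqrt_maj (k + m) - sqrt_maj m) by rewrite addrA subrK.
by apply: bndD => //; exact: sqrt_iter_bndS.
Qed.

Lemma sqrt_iter_conv Y : bnd Y 1 -> mconv (sqrt_iter Y) (mlim (sqrt_iter Y)).
Proof.
move=> bY; apply: mlimP => e e0.
have hs : has_sup (range sqrt_maj).
  by split; [exists (sqrt_maj 0), 0%N|exists 1 => _ [n _ <-]; exact: sqrt_maj_le1].
have [_ [N _ <-] hN] := sup_adherent e0 hs.
have near k l : (N <= k)%N -> (k <= l)%N -> sqrt_maj l - sqrt_maj k <= e.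
  move=> Nk kl; have := sqrt_maj_mono Nk.
  have : sqrt_maj l <= sup (range sqrt_maj).
    by apply: ub_le_sup; [case: hs|exists l].
  by move: hN; lra.
exists N => m n Nm Nn; have [mn|/ltnW nm] := leqP m n.
  by apply: bndC; apply: bnd_le (sqrt_iter_cauchy bY mn); exact: near.
by apply: bnd_le (sqrt_iter_cauchy bY nm); exact: near.
Qed.

Definition msqrt T := 1 - mlim (sqrt_iter (1 - T)).

Section Msqrt.
Variable T : multiplier A.
Hypothesis bT : bnd (1 - T) 1.

Lemma msqrt_bnd : bnd (1 - msqrt T) 1.
Proof.
rewrite /msqrt opprB addrC subrK; apply: mconv_bnd (sqrt_iter_conv bT) _ => n.
by apply: bnd_le (sqrt_iter_bnd n bT); exact: sqrt_maj_le1.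
Qed.

Lemma msqrtE : msqrt T * msqrt T = T.
Proof.
have cz := sqrt_iter_conv bT; have bz := msqrt_bnd.
move: cz bz; rewrite /msqrt; set z := mlim _ => cz.
rewrite opprB addrC subrK => bz.
(* The limit is a fixed point: it is compared with the iterates [N] and [N.+1], using that [w] and
   [z] are contractions. *)
have zE : z = 2^-1%:C *: ((1 - T) + z * z).
  apply/eqP; rewrite -subr_eq0; apply/eqP/bnd_eq0/bnd_lim => e e0; rewrite add0r.
  have [N hN] := cz _ (divr_gt0 e0 (ltr0Sn R 1)).
  set w := sqrt_iter (1 - T) N.
  have -> : z - 2^-1%:C *: (1 - T + z * z) =
      2^-1%:C *: (w * (w - z) + (w - z) * z) - (sqrt_iter (1 - T) N.+1 - z).
    rewrite -[sqrt_iter _ N.+1]/(_ *: (1 - T + w * w)).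
    rewrite mulrBr mulrBl.
    by linear_eq R[i] (multiplier A); ring.
  have -> : e = `|2^-1| * (1 * (e / 2) + e / 2 * 1) + e / 2.
    by rewrite ger0_norm ?invr_ge0// mul1r mulr1 -splitr; field.
  have wz : bnd (w - z) (e / 2) by exact: hN.
  apply: bndB; last by apply: hN; exact: leqnSn.
  apply: bndZr; apply: bndD; apply: bndM => //; last by rewrite divr_ge0 ?ltW.
  by apply: bnd_le (sqrt_iter_bnd N bT); exact: sqrt_maj_le1.
have -> : (1 - z) * (1 - z) =
    T + 2%:C *: (2^-1%:C *: ((1 - T) + z * z) - z).
  rewrite mulrBl mul1r mulrBr mulr1.
  linear_eq R[i] (multiplier A); by field.
by rewrite -zE subrr scaler0 addr0.
Qed.

Lemma msqrt_star : mstar T = T -> mstar (msqrt T) = msqrt T.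
Proof.
move=> sT; rewrite /msqrt mstarB mstar1; congr (1 - _).
have cz := sqrt_iter_conv bT.
rewrite -[RHS]mul1r -[LHS]mulr1.
apply: (mconv_eq (mconv_star cz) cz) => n; rewrite mulr1 mul1r.
elim: n => [|n ih]; first exact: mstar0.
by rewrite [sqrt_iter _ _]/= -/(sqrt_iter _ n) mstarZr mstarD mstarM mstarB
  mstar1 sT ih.
Qed.

End Msqrt.

(** Two operators are allowed because the positivity of [mstar X * X] rests on a relation p^2 y = y
    q^2; [T' = T] is the usual commutation. *)
Lemma msqrt_comm T T' X : bnd (1 - T) 1 -> bnd (1 - T') 1 ->
  T * X = X * T' -> msqrt T * X = X * msqrt T'.
Proof.
move=> bT bT' h; rewrite /msqrt mulrBl mulrBr mul1r mulr1; congr (_ - _).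
apply: mconv_eq (sqrt_iter_conv bT) (sqrt_iter_conv bT') _.
elim=> [|n ih]; first by rewrite mul0r mulr0.
rewrite [sqrt_iter _ _]/= [sqrt_iter (1 - T') _]/= -!/(sqrt_iter _ n).
rewrite mscaleAl mscaleAr; congr (_ *: _).
rewrite mulrDl mulrDr mulrBl mulrBr mul1r mulr1 h; congr (_ + _).
by rewrite -mulrA ih mulrA ih -mulrA.
Qed.

End Completeness.

(** * Positive multipliers *)

Section Positive.
Context {R : realType} {A : cstarAlgType R}.
Local Notation M := (multiplier A).
Implicit Types (B H K P Q S T U W X Y Z : M) (e r t : R).

(** For self-adjoint [T] the inequality |t - T| <= t says that the spectrum lies in [0, 2t]. In this
    form sums of positive elements are positive at once, and [msqrt] applies to T / t when t > 0. *)
Definition pos T := mstar T = T /\ exists2 t, 0 <= t & bnd (msc t - T) t.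

Lemma conj_i : ('i%C^*)%R = - 'i%C :> R[i].
Proof. by apply/eqP; rewrite eq_complex /= oppr0 !eqxx. Qed.

Lemma Re_norm_i : complex.Re `|'i%C : R[i]| = 1.
Proof. by rewrite normc_def /= expr0n expr1n add0r sqrtr1. Qed.

Lemma pos_sa T : pos T -> mstar T = T. Proof. by case. Qed.

Lemma posD S T : pos S -> pos T -> pos (S + T).
Proof.
move=> [sS [s s0 bS]] [sT [t t0 bT]]; split; first by rewrite mstarD sS sT.
exists (s + t); first exact: addr_ge0.
by rewrite mscD opprD addrACA; exact: bndD.
Qed.

Lemma posZ r T : 0 <= r -> pos T -> pos (r%:C *: T).
Proof.
move=> r0 [sT [t t0 bT]]; split; first by rewrite mstarZr sT.
exists (r * t); first exact: mulr_ge0.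
have -> : msc (r * t) - r%:C *: T = r%:C *: (msc t - T).
  by rewrite scalerBr /msc scalerA -rcM.
by rewrite -[X in X * t]ger0_norm//; exact: bndZr.
Qed.

Lemma pos_msc t : 0 <= t -> pos (msc t).
Proof.
move=> t0; split; first exact: mstar_msc.
by exists t => //; rewrite subrr; exact: bnd_le t0 bnd0.
Qed.

Lemma pos1 : pos 1.
Proof. by rewrite -msc1; exact: pos_msc. Qed.

Lemma pos0 : pos 0.
Proof. by rewrite -msc0; exact: pos_msc. Qed.

Lemma bnd_pos T t : mstar T = T -> 0 <= t -> bnd T t -> pos (msc t - T).
Proof.
move=> sT t0 bT; split; first by rewrite mstarB mstar_msc sT.
by exists t => //; rewrite opprB addrC subrK.
Qed.

Lemma bnd_half T r : bnd T (r + r) -> bnd (2^-1%:C *: T) r.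
Proof.
move=> bT; have -> : r = `|2^-1| * (r + r).
  by rewrite ger0_norm ?invr_ge0// -mulr2n mulrnAr -mulrnAl -mulr_natr mulVf
    ?mul1r// pnatr_eq0.
exact: bndZr.
Qed.

Lemma mstar_mul_i H K : mstar H = H -> mstar K = K -> H * K = K * H ->
  mstar (H + 'i%C *: K) * (H + 'i%C *: K) = H * H + K * K.
Proof.
move=> sH sK HK; rewrite mstarD mstarZ sH sK conj_i.
rewrite mulrDl !mulrDr !mscaleAl !mscaleAr HK.
have ii : 'i%C * 'i%C = - 1 :> R[i] by rewrite -expr2 sqr_i.
linear_eq R[i] (multiplier A); ring: ii.
Qed.

(* [1 - H ^ 2 = K ^ 2] where [K] is the imaginary part of the unitary
   [H + i K]. *)
Lemma sa_bnd_sq H : mstar H = H -> bnd H 1 -> bnd (1 - H * H) 1.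
Proof.
move=> sH bH.
have bT : bnd (1 - (1 - H * H)) 1.
  rewrite opprB addrC subrK -[X in bnd _ X]mulr1; exact: bndM.
set K := msqrt (1 - H * H).
have sT : mstar (1 - H * H) = 1 - H * H by rewrite mstarB mstar1 mstarM sH.
have sK : mstar K = K by exact: msqrt_star.
have KH : K * H = H * K.
  by apply: msqrt_comm => //; rewrite mulrBl mulrBr mul1r mulr1 mulrA.
have KK : K * K = 1 - H * H by exact: msqrtE.
set U := H + 'i%C *: K.
have bU : bnd U 1.
  apply: bnd_cstar => //; rewrite mstar_mul_i// KK addrC subrK expr1n.
  exact: bnd1.
have KE : K = 2^-1%:C *: ('i%C *: (mstar U - U)).
  rewrite mstarD mstarZ sH sK conj_i.
  have ii : 'i%C * 'i%C = - 1 :> R[i] by rewrite -expr2 sqr_i.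
  by rewrite /U; linear_eq R[i] (multiplier A); field: ii.
have bK : bnd K 1.
  rewrite KE; apply: bnd_half; have := bndZ 'i%C (bndB (bnd_star bU) bU).
  by rewrite Re_norm_i mul1r.
by rewrite -KK -[X in bnd _ X]mulr1; exact: bndM.
Qed.

Lemma sq_bnd H t : mstar H = H -> 0 <= t -> bnd (H * H) t ->
  bnd (msc t - H * H) t.
Proof.
move=> sH; rewrite le0r => /predU1P[->|t0] bHH.
  by rewrite (bnd_eq0 bHH) msc0 subrr; exact: bnd0.
set r := Num.sqrt t; have r0 : 0 < r by rewrite sqrtr_gt0.
have rr : r * r = t by rewrite -expr2 sqr_sqrtr// ltW.
have bH : bnd H r.
  by apply: bnd_cstar; rewrite ?(ltW r0)// sH expr2 rr.
set H' := r^-1%:C *: H.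
have HE : H = r%:C *: H' by rewrite /H' scalerA -rcM divff ?gt_eqF// scale1r.
have bH' : bnd H' 1.
  have -> : 1 = `|r^-1| * r by rewrite gtr0_norm ?invr_gt0// mulVf ?gt_eqF.
  exact: bndZr.
have sH' : mstar H' = H' by rewrite mstarZr sH.
have -> : msc t - H * H = t%:C *: (1 - H' * H').
  by rewrite HE mscaleAl mscaleAr scalerA -rcM rr -scalerBr.
by rewrite -[X in bnd _ X]mulr1 -{2}(gtr0_norm t0); apply: bndZr;
  exact: sa_bnd_sq.
Qed.

Lemma pos_sq H : mstar H = H -> pos (H * H).
Proof.
move=> sH; have [r r0 bH] := bnd_ex H; split; first by rewrite mstarM sH.
exists (r * r); first by rewrite mulr_ge0// ltW.
apply: sq_bnd => //; first by rewrite mulr_ge0// ltW.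
by apply: bndM => //; exact: ltW.
Qed.

Lemma pos_sqrt T : pos T -> exists H,
  [/\ pos H, H * H = T & forall X, T * X = X * T -> H * X = X * H].
Proof.
move=> [sT [t' t'0 bT']].
(* The added 1 allows the division by [t] when [t'] is zero. *)
pose t := t' + 1; have t0 : 0 < t by rewrite ltr_wpDl.
have bT : bnd (msc t - T) t.
  rewrite mscD msc1 addrAC; apply: bndD => //; exact: bnd1.
set r := Num.sqrt t; have r0 : 0 < r by rewrite sqrtr_gt0.
have rr : r * r = t by rewrite -expr2 sqr_sqrtr// ltW.
set T' := t^-1%:C *: T.
have TE : T = t%:C *: T' by rewrite /T' scalerA -rcM divff ?gt_eqF// scale1r.
have bT1 : bnd (1 - T') 1.
  have -> : 1 - T' = t^-1%:C *: (msc t - T).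
    by rewrite scalerBr /msc scalerA -rcM mulVf ?gt_eqF// scale1r.
  have -> : 1 = `|t^-1| * t by rewrite gtr0_norm ?invr_gt0// mulVf ?gt_eqF.
  exact: bndZr.
have sT' : mstar T' = T' by rewrite mstarZr sT.
exists (r%:C *: msqrt T'); split.
- apply: posZ; first exact: ltW.
  split; first exact: msqrt_star.
  by exists 1 => //; rewrite msc1; exact: msqrt_bnd.
- by rewrite mscaleAl mscaleAr scalerA -rcM rr msqrtE.
- move=> X TX; rewrite mscaleAl mscaleAr; congr (_ *: _).
  by apply: msqrt_comm => //; rewrite /T' mscaleAl mscaleAr TX.
Qed.

(** The constant in [pos] is existential; as [T] is a square, any bound of [T] can take its
    place. *)
Lemma pos_bnd T t : pos T -> 0 <= t -> bnd T t -> bnd (msc t - T) t.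
Proof.
by move=> /pos_sqrt[H [[sH _] <- _]] t0; exact: sq_bnd.
Qed.

(** With commuting roots H of T and K of t - T, the element U = H + i K satisfies U^* U = t, so its
    real part H is bounded by the square root of t. *)
Lemma pos_le_bnd T t : 0 <= t -> pos T -> pos (msc t - T) -> bnd T t.
Proof.
move=> t0 /pos_sqrt[H [[sH _] HH cH]] /pos_sqrt[K [[sK _] KK cK]].
have HK : H * K = K * H.
  apply/esym/cK; rewrite mulrBl mulrBr mscl mscr -HH mulrA; congr (_ - _).
set r := Num.sqrt t; have r0 : 0 <= r by exact: sqrtr_ge0.
have rr : r ^+ 2 = t by rewrite sqr_sqrtr.
set U := H + 'i%C *: K.
have bU : bnd U r.
  apply: bnd_cstar => //; rewrite mstar_mul_i// HH KK addrC subrK rr.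
  by rewrite -[X in bnd _ X]ger0_norm//; exact: bnd_msc.
have HE : H = 2^-1%:C *: (mstar U + U).
  by rewrite /U mstarD mstarZ sH sK conj_i; linear_eq R[i] (multiplier A); field.
have bH : bnd H r.
  by rewrite HE; apply/bnd_half/bndD => //; exact: bnd_star.
by rewrite -HH -rr expr2; exact: bndM.
Qed.

Lemma pos_anti T : pos T -> pos (- T) -> T = 0.
Proof.
move=> pT nT; apply: bnd_eq0; apply: pos_le_bnd => //.
by rewrite msc0 sub0r.
Qed.

Lemma pos_mul P Q : pos P -> pos Q -> P * Q = Q * P -> pos (P * Q).
Proof.
move=> /pos_sqrt[H [[sH _] <- cH]] /pos_sqrt[K [[sK _] <- cK]] h.
have HK : H * K = K * H by apply/esym/cK/esym/cH.
have -> : H * H * (K * K) = (H * K) * (H * K).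
  by rewrite -!mulrA; congr (_ * _); rewrite !mulrA HK.
by apply: pos_sq; rewrite mstarM sH sK.
Qed.

Lemma sa_cube_eq0 W : mstar W = W -> W * (W * W) = 0 -> W = 0.
Proof.
move=> sW W3; apply: sa_sqr_eq0 => //; apply: sa_sqr_eq0.
  by rewrite mstarM sW.
by rewrite -mulrA W3 mulr0.
Qed.

(** Let S be the computed root and W = S - P. From (S + P) W = 0 the positive elements S W^2 and P
    W^2 are opposite, hence both zero; so W^3 = 0 and W = 0. *)
Lemma msqrt_sq P : pos P -> bnd P 1 -> msqrt (P * P) = P.
Proof.
move=> pP bP; have sP := pos_sa pP.
have bT := sa_bnd_sq sP bP.
set S := msqrt _.
have SP : S * P = P * S by apply: msqrt_comm => //; rewrite mulrA.
have sS : mstar S = S by apply: msqrt_star => //; rewrite mstarM sP.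
have SS : S * S = P * P by exact: msqrtE.
have pS : pos S.
  by split=> //; exists 1 => //; rewrite msc1; exact: msqrt_bnd.
clearbody S.
set W := S - P.
have sW : mstar W = W by rewrite mstarB sS sP.
have SW : S * W = W * S by rewrite /W mulrBl mulrBr SP.
have PW : P * W = W * P by rewrite /W mulrBl mulrBr SP.
have SPW : (S + P) * W = 0.
  by rewrite /W mulrDl !mulrBr SS SP addrA subrK subrr.
have h : S * (W * W) = - (P * (W * W)).
  by apply/eqP; rewrite -subr_eq0 opprK -mulrDl mulrA SPW mul0r.
have pSW : pos (S * (W * W)).
  apply: pos_mul => //; first exact: pos_sq.
  by rewrite mulrA SW -mulrA SW mulrA.
have pPW : pos (P * (W * W)).
  apply: pos_mul => //; first exact: pos_sq.
  by rewrite mulrA PW -mulrA PW mulrA.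
have PWW : P * (W * W) = 0.
  by apply: pos_anti => //; rewrite -h.
apply/eqP; rewrite -subr_eq0 -/W; apply/eqP/sa_cube_eq0 => //.
by rewrite {1}/W mulrBl h PWW oppr0 addr0.
Qed.

(** A common rescaling makes [P] and [Q] contractions; [msqrt] then recovers them from their
    squares, and roots inherit intertwining relations. *)
Lemma pos_intertwine P Q Y : pos P -> pos Q ->
  P * P * Y = Y * (Q * Q) -> P * Y = Y * Q.
Proof.
move=> pP pQ h.
have [[r r0 bP] [s s0 bQ]] := (bnd_ex P, bnd_ex Q).
pose t := r + s; have t0 : 0 < t by rewrite addr_gt0.
have t1 : 1 = `|t^-1| * t by rewrite gtr0_norm ?invr_gt0// mulVf ?gt_eqF.
have bnd' X : bnd X t -> bnd (t^-1%:C *: X) 1.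
  by rewrite [X in _ -> bnd _ X]t1; exact: bndZr.
have bP' : bnd (t^-1%:C *: P) 1.
  by apply/bnd'/(bnd_le _ bP); rewrite lerDl ltW.
have bQ' : bnd (t^-1%:C *: Q) 1.
  by apply/bnd'/(bnd_le _ bQ); rewrite lerDr ltW.
have t'0 : 0 <= t^-1 by rewrite invr_ge0 ltW.
have [pP' pQ'] := (posZ t'0 pP, posZ t'0 pQ).
set P' := t^-1%:C *: P in bP' pP'; set Q' := t^-1%:C *: Q in bQ' pQ'.
have : P' * Y = Y * Q'.
  rewrite -(msqrt_sq pP' bP') -(msqrt_sq pQ' bQ'); apply: msqrt_comm.
  - exact: sa_bnd_sq (pos_sa pP') bP'.
  - exact: sa_bnd_sq (pos_sa pQ') bQ'.
  - by rewrite /P' /Q' !(mscaleAl, mscaleAr) h.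
rewrite /P' /Q' mscaleAl mscaleAr => /(congr1 (fun Z => t%:C *: Z)).
by rewrite !scalerA -!rcM divff ?gt_eqF// !scale1r.
Qed.

(* Kaplansky: with [B = X^* X], [a = |B|] and [y = X (a - B)], the element
   [y^* y = - q] is negative whereas [p = y y^*] is positive, so that
   [p y = - y q] and [p^2 y = y q^2]; taking roots, [p y = y q], thus [q = 0]. *)
Lemma pos_star_mul X : pos (mstar X * X).
Proof.
set B := mstar X * X.
have sB : mstar B = B by rewrite mstarM mstarK.
have [a [pa aa ca]] := pos_sqrt (pos_sq sB).
have aB : a * B = B * a by apply: ca; rewrite mulrA.
have sa := pos_sa pa.
set N := a - B; have sN : mstar N = N by rewrite mstarB sa sB.
have aN : a * N = N * a by rewrite /N mulrBl mulrBr aB.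
have NN : N * N = 2%:C *: (a * N).
  rewrite /N !(mulrBr, mulrBl) -aa aB; linear_eq R[i] (multiplier A); ring.
have BN : B * N = - (a * N).
  by rewrite /N !mulrBr -aa aB opprB.
set q := a * (N * N).
have pq : pos q.
  apply: pos_mul => //; first exact: pos_sq.
  by rewrite mulrA aN -mulrA aN mulrA.
set y := X * N; set p := y * mstar y.
have yy : mstar y * y = - q.
  by rewrite /q (mulrA a) aN -mulrA mstarM sN -mulrA (mulrA (mstar X)) BN mulrN.
have pp : pos p.
  have -> : p = (mstar y * y + y * mstar y) + q by rewrite yy addrAC addNr add0r.
  apply: posD => //.
  have -> : mstar y * y + y * mstar y = 2^-1%:C *: ((y + mstar y) * (y + mstar y)
      + ('i%C *: (y - mstar y)) * ('i%C *: (y - mstar y))).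
    have ii : 'i%C * 'i%C = - 1 :> R[i] by rewrite -expr2 sqr_i.
    rewrite mscaleAl mscaleAr scalerA ii !(mulrBr, mulrBl, mulrDl, mulrDr).
    linear_eq R[i] (multiplier A); by field.
  apply: posZ; first by rewrite invr_ge0.
  by apply: posD; apply: pos_sq;
    rewrite ?mstarZ ?mstarB ?mstarD mstarK ?[_ + y]addrC// conj_i scaleNr -scalerN opprB.
have py : p * y = - (y * q) by rewrite /p -mulrA yy mulrN.
clearbody p y; have : p * y = y * q.
  by apply: pos_intertwine => //; rewrite -(mulrA p) py mulrN (mulrA p) py mulNr opprK -mulrA.
rewrite py => /eqP; rewrite -subr_eq0 -opprD oppr_eq0 => /eqP yq.
have {}yq : y * q = 0.
  have E : y * q = 2^-1%:C *: (y * q + y * q).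
    by linear_eq R[i] (multiplier A); field.
  by rewrite E yq scaler0.
have q0 : q = 0.
  apply: sa_sqr_eq0; first exact: pos_sa.
  by rewrite -[LHS]opprK -mulNr -yy -mulrA yq mulr0 oppr0.
have N0 : N = 0.
  apply: sa_cube_eq0 => //.
  by rewrite NN mscaleAr mulrA -aN -mulrA -/q q0 scaler0.
by move: N0 => /eqP; rewrite subr_eq0 => /eqP <-.
Qed.

Lemma pos_conj X T : pos T -> pos (mstar X * T * X).
Proof.
move=> /pos_sqrt[H [[sH _] <- _]]; have := pos_star_mul (H * X).
by rewrite mstarM sH !mulrA.
Qed.

(* The regularized polar part [g] of [s]: [1 - g s g = Y] is a power [y ^ n] of
   [y = 1 - s / t], and [Y s Y <= t y ^ n (1 - y) <= t / (n + 1)]. *)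
Lemma pos_approx (s : M) e : pos s -> 0 < e -> exists g Y,
  [/\ mstar g = g, g * s = s * g, g * s * g = 1 - Y, pos Y & bnd (Y * s * Y) e].
Proof.
move=> ps e0; have [t t0 bs] := bnd_ex s.
set s' := t^-1%:C *: s.
have sE : s = t%:C *: s' by rewrite /s' scalerA -rcM divff ?gt_eqF// scale1r.
have t'0 : 0 <= t^-1 by rewrite invr_ge0 ltW.
have ps' : pos s' by exact: posZ.
have bs' : bnd s' 1.
  have -> : 1 = `|t^-1| * t by rewrite gtr0_norm ?invr_gt0// mulVf ?gt_eqF.
  exact: bndZr.
pose y : M := 1 - s'.
have py : pos y by rewrite /y -msc1; apply: bnd_pos => //; exact: pos_sa.
have by1 : bnd y 1 by rewrite /y -msc1; exact: pos_bnd.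
have ys : s' = 1 - y by rewrite opprB addrC subrK.
have p1y : pos (1 - y) by rewrite -ys.
clearbody y.
have yS n : y * y ^+ n = y ^+ n * y by rewrite -exprS exprSr.
have pyn n : pos (y ^+ n).
  elim: n => [|n ih]; first by rewrite expr0; exact: pos1.
  by rewrite exprS; apply: pos_mul.
have byn n : bnd (y ^+ n) 1.
  elim: n => [|n ih]; first by rewrite expr0; exact: bnd1.
  by rewrite exprS -[X in bnd _ X]mulr1; exact: bndM.
(* The factor 1 - y^(n+1) is 1 - y times a sum of n + 1 powers of y, each at least y^n. *)
have pE n : pos (1 - y ^+ n.+1 - n.+1%:R%:C *: (y ^+ n * (1 - y))).
  elim: n => [|n ih].
    by rewrite expr1 expr0 mul1r scale1r subrr; exact: pos0.
  have -> : 1 - y ^+ n.+2 - n.+2%:R%:C *: (y ^+ n.+1 * (1 - y)) =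
      y * (1 - y ^+ n.+1 - n.+1%:R%:C *: (y ^+ n * (1 - y))) +
      (1 - y) * (1 - y ^+ n.+1).
    rewrite !exprS -mulrA; have := yS n; set Y := y ^+ n => yY.
    rewrite !mulrBr !mulr1 -yY mulrBl mul1r !mscaleAr ?mulrBr.
    rewrite -(natr1 n.+1) rcD.
    linear_eq R[i] (multiplier A); ring.
  apply: posD; apply: pos_mul => //.
  - rewrite !(mulrBr, mulrBl, mulr1, mul1r, mscaleAr, mscaleAl) yS.
    by rewrite (yS n) (mulrA y) (yS n).
  - by rewrite -msc1; apply: bnd_pos => //; exact: pos_sa.
  - rewrite !(mulrBr, mulrBl, mulr1, mul1r) yS.
    by linear_eq R[i] (multiplier A); ring.
have bE n : bnd (y ^+ n * (1 - y)) n.+1%:R^-1.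
  apply: pos_le_bnd; first by rewrite invr_ge0.
    apply: pos_mul => //.
    by rewrite mulrBl mulrBr mulr1 mul1r yS.
  have -> : msc n.+1%:R^-1 - y ^+ n * (1 - y) = n.+1%:R^-1%:C *:
      ((1 - y ^+ n.+1 - n.+1%:R%:C *: (y ^+ n * (1 - y))) + y ^+ n.+1).
    rewrite addrAC subrK scalerBr scalerA -rcM mulVf ?scale1r//.
    by rewrite pnatr_eq0.
  by apply: posZ; rewrite ?invr_ge0//; exact: posD.
have [n hn] : exists n, t * n.+1%:R^-1 <= e.
  exists (Num.truncn (t / e)); rewrite ler_pdivrMr ?ltr0Sn// mulrC.
  by rewrite -ler_pdivrMr// ltW// truncnS_gt.
(* [G] is the geometric sum 1 + y + ... + y^(n-1), a truncated inverse of s / t; [g] is the root of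
   G / t. *)
have [G [pG Gy GE]] : exists G, [/\ pos G, G * y = y * G & G * (1 - y) = 1 - y ^+ n].
  elim: n {hn} => [|n [G [pG Gy GE]]].
    by exists 0; split; rewrite ?mul0r ?mulr0 ?expr0 ?subrr//; exact: pos0.
  exists (1 + y * G); split.
  - by apply: posD; [exact: pos1|exact: pos_mul].
  - by rewrite mulrDl mulrDr mul1r mulr1 -mulrA Gy.
  - rewrite mulrDl mul1r -mulrA GE mulrBr mulr1 -exprS.
    by rewrite addrA subrK.
have [g [[sg _] gg cg]] := pos_sqrt (posZ t'0 pG).
have gs : g * s = s * g.
  apply: cg; rewrite mscaleAl mscaleAr; congr (_ *: _).
  have -> : s = t%:C *: (1 - y) by rewrite sE ys.
  by rewrite mscaleAl mscaleAr mulrBl mulrBr mulr1 mul1r Gy.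
exists g, (y ^+ n); split => //.
- rewrite gs -mulrA gg mscaleAr sE mscaleAl scalerA -rcM mulVf ?gt_eqF//.
  by rewrite scale1r ys -GE mulrBl mulrBr mul1r mulr1 Gy.
- apply: bnd_le hn _; rewrite sE mscaleAr mscaleAl -{2}(gtr0_norm t0).
  apply: bndZr; rewrite -[X in bnd _ X]mulr1; apply: bndM => //.
    by rewrite invr_ge0.
  by rewrite ys; exact: bE.
Qed.

End Positive.

Section CstarIdeals.
Context {R : realType} {A : cstarAlgType R}.
Implicit Types (x y z a : A) (S T X Y : multiplier A) (e r t : R) (I : set A).

Lemma pos_mono_bnd S T t : 0 <= t -> pos S -> pos T -> pos (T - S) ->
  bnd T t -> bnd S t.
Proof.
move=> t0 pS pT pTS bT; apply: pos_le_bnd => //.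
rewrite -[msc t](subrK T) -addrA; apply: posD => //.
by apply: bnd_pos => //; exact: pos_sa.
Qed.

(** Controls the error X Y left by [pos_approx] for every X whose square X^* X is dominated by S. *)
Lemma bnd_dominated S X Y r : 0 <= r -> pos S -> pos (S - mstar X * X) ->
  mstar Y = Y -> bnd (Y * S * Y) (r ^+ 2) -> bnd (X * Y) r.
Proof.
move=> r0 pS pSX sY bS; apply: bnd_cstar => //.
have cY T : pos T -> pos (Y * T * Y) by move=> /(pos_conj Y); rewrite sY.
have E : mstar (X * Y) * (X * Y) = Y * (mstar X * X) * Y.
  by rewrite mstarM sY !mulrA.
rewrite E; apply: (pos_mono_bnd _ _ _ _ bS); first exact: exprn_ge0.
- exact/cY/pos_star_mul.
- exact: cY.
- by rewrite -mulrBl -mulrBr; exact: cY.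
Qed.

Lemma rmulB a b T : rmul (a - b) T = rmul a T - rmul b T.
Proof. by apply: lmul_inj; rewrite lmulB !lmul_rmul lmulB mulrBl. Qed.

Lemma rmulM a b T : rmul (a ** b) T = a ** rmul b T.
Proof. by apply: lmul_inj; rewrite lmulM !lmul_rmul lmulM mulrA. Qed.

Lemma nrm_rmul a T r : bnd T r -> nrm (rmul a T) <= r * nrm a.
Proof.
by move=> /bnd_star bT; rewrite nrm_star -(nrm_star a); exact: bT.
Qed.

(** Take u = g s g with s = x^* x: then u = 1 - Y as multipliers, so x - x u = x Y is small. Written
    as g^2 (x^* x), u is a left multiple of x. *)
Lemma cstar_ideal_approx I x e : closed_ideal I -> I x -> 0 < e ->
  exists u, [/\ I u, star u = u & nrm (x - x ** u) <= e].
Proof.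
move=> cI Ix e0; set s := lmul (star x ** x).
have sE : s = mstar (lmul x) * lmul x by rewrite /s lmulM lmul_star.
have ps : pos s by rewrite sE; exact: pos_star_mul.
have [g [Y [sg gs gsg pY bY]]] := pos_approx ps (exprn_gt0 2 e0).
exists ((g * g) (star x ** x)).
have uE : lmul ((g * g) (star x ** x)) = 1 - Y.
  by rewrite -mult_lmul -/s -mulrA gs mulrA.
split.
- by rewrite multM; exact: ideal_mull.
- by apply: lmul_inj; rewrite lmul_star uE mstarB mstar1 (pos_sa pY).
- apply: nrm_bnd; first exact: ltW.
  rewrite lmulB lmulM uE mulrBr mulr1 opprB addrC subrK.
  apply: (bnd_dominated (ltW e0) ps) => //; last exact: pos_sa.
  by rewrite sE subrr; exact: pos0.
Qed.

(** The element z T is a limit of z (u T), where u T belongs to [A]. *)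
Lemma rmul_ideal I z T : closed_ideal I -> I z -> I (rmul z T).
Proof.
move=> cI Iz; have [_ clI] := cI; apply: (closedP clI) => e e0.
have [r r0 bT] := bnd_ex T.
have e'0 : 0 < e / 2 / r by rewrite !divr_gt0.
have [u [Iu _ zu]] := cstar_ideal_approx cI Iz e'0.
exists (z ** rmul u T); first exact: (ideal_mulr cI).
rewrite -rmulM -rmulB (le_lt_trans (nrm_rmul _ bT))//.
rewrite (@le_lt_trans _ _ (r * (e / 2 / r)))// ?ler_wpM2l// ?ltW//.
by rewrite mulrC divfK ?gt_eqF// gtr_pMr// invf_lt1// ltr1n.
Qed.

End CstarIdeals.

(** * Hahn-Banach *)

Section HahnBanach.
Context {R : realType} {V : lmodType R[i]}.
Implicit Types (x y z c : V) (p q f : V -> R) (r s t : R) (C : V -> R -> Prop).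

Definition sublinear q := (forall x y, q (x + y) <= q x + q y) /\
  (forall r x, 0 <= r -> q (r%:C *: x) = r * q x).

(** A cone in V x R; [C c s] stands for the requirement [s <= f c] on the functional to be built. *)
Definition convex_cone C := [/\ C 0 0,
  forall c d s t, C c s -> C d t -> C (c + d) (s + t) &
  forall r c s, 0 < r -> C c s -> C (r%:C *: c) (r * s)].

Lemma sublinear0 q : sublinear q -> q 0 = 0.
Proof. by move=> [_ qZ]; rewrite -(scale0r 0) -[0 : R[i]]/(0%:C) qZ// mul0r. Qed.

Lemma sublinearN q x : sublinear q -> - q (- x) <= q x.
Proof.
by move=> sq; rewrite -subr_ge0 opprK -(sublinear0 sq) -(subrr x) sq.1.
Qed.

Lemma sublinearZ_le q : q 0 = 0 ->
  (forall r x, 0 < r -> q (r%:C *: x) <= r * q x) ->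
  forall r x, 0 <= r -> q (r%:C *: x) = r * q x.
Proof.
move=> q0 qr r x; rewrite le0r => /predU1P[->|r0].
  by rewrite mul0r -[0%:C]/(0 : R[i]) scale0r.
apply/le_anti; rewrite qr//=.
have rV : 0 < r^-1 by rewrite invr_gt0.
have := qr _ (r%:C *: x) rV.
rewrite scalerA -rcM mulVf ?gt_eqF// scale1r mulrC ler_pdivlMr//.
by rewrite mulrC.
Qed.

(** For a convex cone with [s <= q c] throughout, this is the largest sublinear functional below [q]
    whose value at [- c] is at most [- s] whenever [C c s]. *)
Definition cone_inf q C x := inf [set v | exists c s, C c s /\ v = q (x + c) - s].

Lemma cone_inf_sublinear q C : sublinear q -> convex_cone C ->
  (forall c s, C c s -> s <= q c) ->
  [/\ sublinear (cone_inf q C), forall x, cone_inf q C x <= q x &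
      forall c s, C c s -> cone_inf q C (- c) <= - s].
Proof.
move=> sq [C0 CD CZ] Cq; pose E x := [set v | exists c s, C c s /\ v = q (x + c) - s].
have lbE x : lbound (E x) (- q (- x)).
  move=> _ [c [s [Ccs ->]]]; rewrite lerBrDr addrC lerBlDr.
  by rewrite (le_trans (Cq _ _ Ccs))// -{1}(addKr x c) [leRHS]addrC sq.1.
have neE x : E x !=set0 by exists (q (x + 0) - 0), 0, 0.
have hasE x : has_inf (E x) by split=> //; exists (- q (- x)); exact: lbE.
have ge x c s : C c s -> cone_inf q C x <= q (x + c) - s.
  by move=> Ccs; apply: ge_inf; [case: (hasE x)|exists c, s].
have le x v : (forall c s, C c s -> v <= q (x + c) - s) -> v <= cone_inf q C x.
  by move=> h; apply: lb_le_inf => [|_ [c [s [Ccs ->]]]]; [exact: neE|exact: h].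
split.
- split=> [x y|].
    rewrite -lerBlDl; apply: (le _ _) => c s Ccs; rewrite lerBlDl -lerBlDr.
    apply: (le _ _) => d t Cdt; rewrite lerBlDr.
    rewrite (le_trans (ge _ _ _ (CD _ _ _ _ Cdt Ccs)))// addrACA opprD.
    by rewrite [leRHS]addrACA lerD2r sq.1.
  apply: sublinearZ_le => [|r x r0].
    apply/le_anti/andP; split.
      by rewrite (le_trans (ge 0 0 0 C0))// addr0 subr0 sublinear0.
    by apply: (le _ _) => c s Ccs; rewrite add0r subr_ge0 Cq.
  rewrite -ler_pdivrMl//; apply: (le _ _) => c s Ccs; rewrite ler_pdivrMl//.
  rewrite (le_trans (ge _ _ _ (CZ _ _ _ r0 Ccs)))// -scalerDr sq.2 ?(ltW r0)//.
  by rewrite mulrBr.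
- by move=> x; rewrite (le_trans (ge x 0 0 C0))// addr0 subr0.
- move=> c s Ccs; rewrite (le_trans (ge _ _ _ Ccs))// addNr sublinear0//.
  by rewrite sub0r.
Qed.

(* A minimal sublinear functional is linear, as it coincides with its
   [cone_inf] along the ray through [(z, q z)]. *)
Lemma minimal_sublinear p : sublinear p ->
  exists q, [/\ sublinear q, forall x, q x <= p x &
    forall q', sublinear q' -> (forall x, q' x <= q x) -> q' = q].
Proof.
move=> sp; pose T := {q : V -> R | sublinear q /\ forall x, q x <= p x}.
(* The order is reversed, so that a maximal element is a minimal functional; the common lower bound
   - p (- x) makes infima of chains finite. *)
pose le (a b : T) := `[< forall x, sval b x <= sval a x >].
have p_ge (a : T) x : - p (- x) <= sval a x.
  case: a => a [sa ap] /=; rewrite (le_trans _ (sublinearN x sa))//.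
  by rewrite lerN2.
have Teq (a b : T) : sval a = sval b -> a = b.
  by case: a b => [a ha] [b hb] /= ab; subst b; congr exist; exact: Prop_irrelevance.
have [//|||Q tot|[q [sq qp]] qmin] := @Zorn T le.
- by move=> a; apply/asboolP.
- move=> a b c /asboolP ab /asboolP bc; apply/asboolP => x.
  exact: le_trans (bc x) (ab x).
- move=> a b /asboolP ab /asboolP ba; apply: Teq; apply/funext => x.
  by apply/le_anti; rewrite ab ba.
- have [[a0 Qa0]|Q0] := pselect (exists a, Q a); last first.
    exists (exist _ p (conj sp (fun x => lexx (p x)))) => a Qa.
    by case: Q0; exists a.
  pose E x := [set v | exists a, Q a /\ v = sval a x].
  pose m x := inf (E x).
  have ge x a : Q a -> m x <= sval a x.
    move=> Qa; apply: ge_inf; last by exists a.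
    by exists (- p (- x)) => _ [b [_ ->]].
  have lem x v : (forall a, Q a -> v <= sval a x) -> v <= m x.
    by move=> h; apply: lb_le_inf => [|_ [a [Qa ->]]]; [exists (sval a0 x), a0|exact: h].
  have sm : sublinear m.
    split=> [x y|].
      rewrite -lerBlDl; apply: (lem _ _) => a Qa; rewrite lerBlDl -lerBlDr.
      apply: (lem _ _) => b Qb; rewrite lerBlDr.
      have [/asboolP ab|/asboolP ba] := tot a b Qa Qb.
        rewrite (le_trans (ge _ _ Qb))// (le_trans ((svalP b).1.1 _ _))//.
        by rewrite lerD2l.
      rewrite (le_trans (ge _ _ Qa))// (le_trans ((svalP a).1.1 _ _))//.
      by rewrite lerD2r.
    apply: sublinearZ_le => [|r x r0].
      apply/le_anti/andP; split.
        by rewrite (le_trans (ge _ _ Qa0))// (sublinear0 (svalP a0).1).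
      by apply: (lem _ _) => a Qa; rewrite (sublinear0 (svalP a).1).
    rewrite -ler_pdivrMl//; apply: (lem _ _) => a Qa; rewrite ler_pdivrMl//.
    by rewrite -(svalP a).1.2 ?(ltW r0)//; exact: ge.
  have mp x : m x <= p x by rewrite (le_trans (ge x a0 Qa0))// (svalP a0).2.
  exists (exist _ m (conj sm mp)) => a Qa; apply/asboolP => x; exact: ge.
- exists q; split=> // q' sq' q'q.
  have q'p x : q' x <= p x by exact: le_trans (q'q x) (qp x).
  by have /(congr1 sval) := qmin (exist _ q' (conj sq' q'p)) (asboolT q'q).
Qed.

Lemma hahn_banach_cone p C : sublinear p -> convex_cone C ->
  (forall c s, C c s -> s <= p c) ->
  exists f, [/\ forall x y, f (x + y) = f x + f y,
    forall r x, f (r%:C *: x) = r * f x, forall x, f x <= p x &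
    forall c s, C c s -> s <= f c].
Proof.
move=> sp cC Cp; have [sp' p'p Cp'] := cone_inf_sublinear sp cC Cp.
have [f [sf fp' fmin]] := minimal_sublinear sp'.
have fN z : f (- z) = - f z.
  pose ray c s := exists2 t, 0 <= t & c = t%:C *: z /\ s = t * f z.
  have ray_cone : convex_cone ray.
    split=> [|c d s t [a a0 [-> ->]] [b b0 [-> ->]]|r c s r0 [a a0 [-> ->]]].
    - by exists 0 => //; rewrite mul0r -[0%:C]/(0 : R[i]) scale0r.
    - by exists (a + b); rewrite ?addr_ge0// rcD scalerDl mulrDl.
    - by exists (r * a); rewrite ?mulr_ge0 ?(ltW r0)// scalerA rcM mulrA.
  have ray_le c s : ray c s -> s <= f c.
    by move=> [t t0 [-> ->]]; rewrite sf.2.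
  have [sg gf gray] := cone_inf_sublinear sf ray_cone ray_le.
  apply/le_anti/andP; split; last by rewrite lerNl sublinearN.
  rewrite -{1}(fmin _ sg gf); apply: gray.
  by exists 1; rewrite ?ler01// mul1r -[1%:C]/(1 : R[i]) scale1r.
exists f; split.
- move=> x y; apply/le_anti; rewrite sf.1/= -lerN2 -fN !opprD -!fN.
  exact: sf.1.
- move=> r x; have [r0|/ltW r0] := leP 0 r; first exact: sf.2.
  rewrite -[r]opprK rcN scaleNr fN sf.2 ?oppr_ge0//.
  ring.
- by move=> x; exact: le_trans (fp' x) (p'p x).
- by move=> c s Ccs; rewrite -lerN2 -fN; exact: le_trans (fp' _) (Cp' _ _ Ccs).
Qed.

End HahnBanach.

Section Separation.
Context {R : realType} {A : banachAlgType R}.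
Implicit Types (x y : A) (K : set A).

Lemma hahn_banach_separation K x0 : linear_subspace K -> ~ closure K x0 ->
  exists f : A -> R, [/\ forall x y, f (x + y) = f x + f y,
    forall r x, f (r%:C *: x) = r * f x, forall x, f x <= nrm x,
    forall k, K k -> f k = 0 & 0 < f x0].
Proof.
move=> sK /closure_nrm/existsNP[d /not_implyP[d0 hd]].
have {}hd k : K k -> d <= nrm (x0 + k).
  move=> Kk; rewrite leNgt; apply/negP => h; apply: hd; exists (- k).
    exact: subspaceN.
  by rewrite opprK.
(* Generated by (x0, d) and by [K] at height 0: the functional is at least [d] at [x0], and
   nonnegative on the subspace [K], hence zero there. *)
pose C x s := exists k t, [/\ K k, 0 <= t, x = t%:C *: x0 + k & s = t * d].
have cC : convex_cone C.
  split=> [|x y s t [k [a [Kk a0 -> ->]]] [l [b [Kl b0 -> ->]]]|].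
  - exists 0, 0; split; rewrite ?mul0r//; first exact: subspace0.
    by rewrite -[0%:C]/(0 : R[i]) scale0r addr0.
  - exists (k + l), (a + b); split; rewrite ?addr_ge0 ?mulrDl//.
      exact: subspaceD.
    by rewrite addrACA rcD scalerDl.
  - move=> r x s r0 [k [a [Kk a0 -> ->]]].
    exists (r%:C *: k), (r * a); split; rewrite ?mulr_ge0 ?(ltW r0) ?mulrA//.
      exact: subspaceZ.
    by rewrite scalerDr scalerA rcM.
have Cp x s : C x s -> s <= nrm x.
  move=> [k [t [Kk + -> ->]]]; rewrite le0r => /predU1P[->|t0].
    by rewrite mul0r nrm_ge0.
  have -> : t%:C *: x0 + k = t%:C *: (x0 + t^-1%:C *: k).
    by rewrite scalerDr scalerA -rcM divff ?gt_eqF// scale1r.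
  rewrite nrmZr gtr0_norm// ler_pM2l//; apply: hd; exact: subspaceZ.
have sp : sublinear (@nrm R A).
  by split=> [x y|r x r0]; [exact: nrmD|rewrite nrmZr ger0_norm].
have [f [fD fZ fp fC]] := hahn_banach_cone sp cC Cp.
have f0 k : K k -> 0 <= f k.
  move=> Kk; apply: fC; exists k, 0; split; rewrite ?mul0r//.
  by rewrite -[0%:C]/(0 : R[i]) scale0r add0r.
have fN x : f (- x) = - f x.
  apply: (addrI (f x)); rewrite -fD !subrr.
  by apply: (addrI (f 0)); rewrite -fD !addr0.
exists f; split=> // [k Kk|].
  apply/le_anti; rewrite f0// andbT -oppr_ge0 -fN f0//; exact: subspaceN.
rewrite (lt_le_trans d0)//; apply: fC; exists 0, 1; split; rewrite ?mul1r//.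
  exact: subspace0.
by rewrite -[1%:C]/(1 : R[i]) scale1r addr0.
Qed.

End Separation.

(** * From a functional vanishing on commutators to a trace *)

Section TraceExtension.
Context {R : realType} {A : cstarAlgType R}.
Implicit Types (x y z w a : A) (S T X Y : multiplier A) (e r t : R).
Implicit Types (zs ws : seq A).

Variables (I : set A) (f : A -> R).
Hypotheses (cI : closed_ideal I).
Hypotheses (fD : forall x y, f (x + y) = f x + f y)
  (fZ : forall r x, f (r%:C *: x) = r * f x) (fb : forall x, f x <= nrm x)
  (f0 : forall z a, I z -> f (commutator z a) = 0).

Let f_0 : f 0 = 0.
Proof. by apply: (addrI (f 0)); rewrite -fD !addr0. Qed.

Let fN x : f (- x) = - f x.
Proof. by apply: (addrI (f x)); rewrite -fD !subrr. Qed.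

Let fB x y : f (x - y) = f x - f y. Proof. by rewrite fD fN. Qed.

Definition sumsq zs : A := \sum_(z <- zs) star z ** z.

Definition fsum zs : R := \sum_(z <- zs) f (z ** star z).

Definition admissible T zs :=
  {in zs, forall z, I z} /\ pos (T - lmul (sumsq zs)).

(* [f] is not positive; among positive elements, [trsup] is the positive part
   of [f] for the equivalence relating [sum z^* z] to [sum z z^*]. *)
Definition trsup T : R := sup [set fsum zs | zs in [set zs | admissible T zs]].

Lemma sumsq_cons z zs : sumsq (z :: zs) = star z ** z + sumsq zs.
Proof. by rewrite /sumsq big_cons. Qed.

Lemma fsum_cons z zs : fsum (z :: zs) = f (z ** star z) + fsum zs.
Proof. by rewrite /fsum big_cons. Qed.

Lemma lmul_sumsq_cons z zs :
  lmul (sumsq (z :: zs)) = mstar (lmul z) * lmul z + lmul (sumsq zs).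
Proof. by rewrite sumsq_cons lmulD lmulM lmul_star. Qed.

Lemma lmul_sumsq_nil : lmul (sumsq [::]) = 0.
Proof. by rewrite /sumsq big_nil lmul0. Qed.

Lemma pos_sumsq zs : pos (lmul (sumsq zs)).
Proof.
elim: zs => [|z zs ih]; first by rewrite lmul_sumsq_nil; exact: pos0.
by rewrite lmul_sumsq_cons; apply: posD => //; exact: pos_star_mul.
Qed.

Lemma pos_sumsq_mem z zs : z \in zs ->
  pos (lmul (sumsq zs) - mstar (lmul z) * lmul z).
Proof.
elim: zs => // w zs ih; rewrite in_cons => /predU1P[->|/ih h].
  by rewrite lmul_sumsq_cons addrC addKr; exact: pos_sumsq.
rewrite lmul_sumsq_cons -addrA; apply: posD => //; exact: pos_star_mul.
Qed.

(** Each difference is [f] of a commutator with an entry in [I]. This bounds [fsum] by the norm of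
    [sumsq], and thus by that of [T]. *)
Lemma fsum_sumsq zs : {in zs, forall z, I z} -> fsum zs = f (sumsq zs).
Proof.
elim: zs => [|z zs ih] h; first by rewrite /fsum /sumsq !big_nil f_0.
rewrite fsum_cons sumsq_cons fD ih; last first.
  by move=> w wzs; apply: h; rewrite in_cons wzs orbT.
congr (_ + _); apply/eqP; rewrite -subr_eq0 -fB; apply/eqP/f0/h.
exact: mem_head.
Qed.

Lemma fsum_le T zs t : 0 <= t -> pos T -> bnd T t -> admissible T zs ->
  fsum zs <= t.
Proof.
move=> t0 pT bT [h pTz]; rewrite fsum_sumsq// (le_trans (fb _))//.
apply: nrm_bnd => //; exact: pos_mono_bnd t0 (pos_sumsq zs) pT pTz bT.
Qed.

Lemma admissible_nil T : pos T -> admissible T [::].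
Proof. by move=> pT; split=> //; rewrite lmul_sumsq_nil subr0. Qed.

Let trsup_has_sup T : pos T ->
  has_sup [set fsum zs | zs in [set zs | admissible T zs]].
Proof.
move=> pT; split; first by exists (fsum [::]), [::] => //; exact: admissible_nil.
have [r r0 bT] := bnd_ex T.
by exists r => _ [zs hz <-]; apply: fsum_le hz => //; exact: ltW.
Qed.

Lemma trsup_ge T zs : pos T -> admissible T zs -> fsum zs <= trsup T.
Proof.
move=> pT hz; apply: ub_le_sup; last by exists zs.
by case: (trsup_has_sup pT).
Qed.

Lemma trsup_le T r : pos T -> (forall zs, admissible T zs -> fsum zs <= r) ->
  trsup T <= r.
Proof.
move=> pT h; apply: ge_sup => [|_ [zs hz <-]]; last exact: h.
by case: (trsup_has_sup pT).
Qed.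

Lemma trsup_ge0 T : pos T -> 0 <= trsup T.
Proof.
move=> pT; have := trsup_ge pT (admissible_nil pT).
by rewrite /fsum big_nil.
Qed.

Lemma trsup_bnd T t : 0 <= t -> pos T -> bnd T t -> trsup T <= t.
Proof. by move=> t0 pT bT; apply: trsup_le => // zs; exact: fsum_le. Qed.

(* Riesz decomposition, with [g] a regularized inverse square root of
   [S = Y1^* Y1 + Y2^* Y2]: each [z] is replaced by [z g Y1^*] and [z g Y2^*]. *)
Lemma fsum_riesz Y1 Y2 zs :
  admissible (mstar Y1 * Y1 + mstar Y2 * Y2) zs ->
  fsum zs <= trsup (Y1 * mstar Y1) + trsup (Y2 * mstar Y2).
Proof.
set S := _ + _ => -[Iz pSz].
have pS : pos S by apply: posD; exact: pos_star_mul.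
have pY Y : pos (Y * mstar Y) by have := pos_star_mul (mstar Y); rewrite mstarK.
(* Regularization costs at most [d * nrm z] for each [z], whence the choice d = e / (N + 1). *)
pose N := \sum_(z <- zs) nrm z.
have N0 : 0 <= N by apply: sumr_ge0 => z _; exact: nrm_ge0.
apply/ler_addgt0Pr => e e0.
have k0 : 0 < N + 1 by rewrite ltr_wpDl.
have d0 : 0 < e / (N + 1) by rewrite divr_gt0.
set d := e / (N + 1) in d0 *.
have [g [Y [sg gS gSg pY' bY]]] := pos_approx pS (exprn_gt0 2 d0).
pose v Y0 z := rmul z (g * mstar Y0).
have lv Y0 z : lmul (v Y0 z) = lmul z * g * mstar Y0.
  by rewrite /v lmul_rmul mulrA.
have sumv Y0 ws : lmul (sumsq (map (v Y0) ws)) =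
    Y0 * g * lmul (sumsq ws) * g * mstar Y0.
  elim: ws => [|w ws ih]; first by rewrite lmul_sumsq_nil mulr0 !mul0r.
  rewrite /= !lmul_sumsq_cons ih mulrDr !mulrDl lv !mstarM mstarK sg.
  by rewrite !mulrA.
have adm Y0 : pos (S - mstar Y0 * Y0) -> admissible (Y0 * mstar Y0) (map (v Y0) zs).
  move=> _; split=> [_ /mapP[z zzs ->]|]; first by apply: rmul_ideal => //; exact: Iz.
  rewrite sumv.
  (* Admissibility comes from g (sum z^* z) g <= g S g = 1 - Y <= 1, conjugated by [Y0]. *)
  have -> : Y0 * mstar Y0 - Y0 * g * lmul (sumsq zs) * g * mstar Y0 =
      mstar (mstar Y0) * Y * mstar Y0 +
      mstar (g * mstar Y0) * (S - lmul (sumsq zs)) * (g * mstar Y0).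
    have -> : Y = 1 - g * S * g by rewrite gSg opprB addrC subrK.
    rewrite !mstarK mstarM mstarK sg !(mulrBr, mulrBl, mulr1) !mulrA.
    by linear_eq R[i] (multiplier A); ring.
  by apply: posD; exact: pos_conj.
have p1 : pos (S - mstar Y1 * Y1) by rewrite /S addrC addKr; exact: pos_star_mul.
have p2 : pos (S - mstar Y2 * Y2) by rewrite /S addrK; exact: pos_star_mul.
apply: (@le_trans _ _ (fsum (map (v Y1) zs) + fsum (map (v Y2) zs) + e)); last first.
  by rewrite lerD2r lerD// trsup_ge//; exact: adm.
apply: (@le_trans _ _ (fsum (map (v Y1) zs) + fsum (map (v Y2) zs) + d * N)); last first.
  rewrite lerD2l /d mulrAC ler_pdivrMr// ler_wpM2l ?(ltW e0)// lerDl//.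
rewrite /fsum !big_map /N mulr_sumr -!big_split /=.
rewrite big_seq [leRHS]big_seq; apply: ler_sum => z zzs.
(* The two pieces add up to z g S g z^* = z (1 - Y) z^*; the defect z Y z^* is small because z^* z
   <= S. *)
have zE : v Y1 z ** star (v Y1 z) + v Y2 z ** star (v Y2 z) =
    z ** star z - rmul z Y ** star z.
  apply: lmul_inj; rewrite lmulD lmulB !lmulM.
  rewrite (lmul_star (v Y1 z)) (lmul_star (v Y2 z)) (lmul_star z) !lv lmul_rmul.
  rewrite !mstarM !mstarK sg.
  have -> : Y = 1 - g * S * g by rewrite gSg opprB addrC subrK.
  rewrite /S !(mulrBr, mulrBl, mulrDr, mulrDl, mulr1) !mulrA.
  by linear_eq R[i] (multiplier A); ring.
rewrite -fD zE fB -addrA lerDl addrC subr_ge0.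
rewrite (le_trans (fb _))// (le_trans (nrmM _ _))// nrm_star.
rewrite ler_wpM2r ?nrm_ge0//; apply: nrm_bnd; first exact: ltW.
rewrite lmul_rmul; apply: (bnd_dominated (ltW d0) pS) => //; last exact: pos_sa.
rewrite -[S](subrK (lmul (sumsq zs))) -addrA; apply: posD => //.
exact: pos_sumsq_mem.
Qed.

(** Riesz decomposition along the roots of [S] and [T] gives one inequality, concatenation of
    families the other. *)
Lemma trsupD S T : pos S -> pos T -> trsup (S + T) = trsup S + trsup T.
Proof.
move=> pS pT; have pST := posD pS pT; apply/le_anti/andP; split.
  have [Y1 [[s1 _] Y1E _]] := pos_sqrt pS; have [Y2 [[s2 _] Y2E _]] := pos_sqrt pT.
  apply: trsup_le => // zs hz.
  have := @fsum_riesz Y1 Y2 zs; rewrite s1 s2 Y1E Y2E; exact.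
rewrite -lerBrDr; apply: trsup_le => // zs [Iz pz].
rewrite lerBrDr addrC -lerBrDr; apply: trsup_le => // ws [Iw pw].
rewrite lerBrDr.
have -> : fsum ws + fsum zs = fsum (ws ++ zs) by rewrite /fsum big_cat.
apply: trsup_ge => //; split.
  by move=> z; rewrite mem_cat => /orP[]; [exact: Iw|exact: Iz].
have -> : S + T - lmul (sumsq (ws ++ zs)) =
    (S - lmul (sumsq zs)) + (T - lmul (sumsq ws)).
  have -> : sumsq (ws ++ zs) = sumsq ws + sumsq zs by rewrite /sumsq big_cat.
  rewrite lmulD; by linear_eq R[i] (multiplier A); ring.
exact: posD.
Qed.

Lemma trsup0 : trsup 0 = 0.
Proof.
have := trsupD pos0 pos0; rewrite addr0 => /eqP.
by rewrite addrC -subr_eq0 opprD addrA subrr sub0r oppr_eq0 => /eqP.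
Qed.

(** Riesz decomposition with [Y2 = 0], applied to [X] and to [mstar X]. *)
Lemma trsup_tr X : trsup (mstar X * X) = trsup (X * mstar X).
Proof.
have h Y : trsup (mstar Y * Y) <= trsup (Y * mstar Y).
  apply: trsup_le => [|zs hz]; first exact: pos_star_mul.
  have := @fsum_riesz Y 0 zs; rewrite mulr0 addr0 mul0r trsup0 addr0; exact.
by apply/le_anti; rewrite h/=; have := h (mstar X); rewrite mstarK.
Qed.

Lemma trsupZ r T : 0 <= r -> pos T -> trsup (r%:C *: T) = r * trsup T.
Proof.
rewrite le0r => /predU1P[->|r0] pT.
  by rewrite -[0%:C]/(0 : R[i]) scale0r mul0r trsup0.
have h s S : 0 < s -> pos S -> s * trsup S <= trsup (s%:C *: S).
  move=> s0 pS; rewrite -ler_pdivlMl//; apply: trsup_le => // zs [Iz pz].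
  rewrite ler_pdivlMl//.
  set q := Num.sqrt s; have qq : q * q = s by rewrite -expr2 sqr_sqrtr// ltW.
  have <- : fsum (map (fun z => q%:C *: z) zs) = s * fsum zs.
    rewrite /fsum big_map mulr_sumr; apply: eq_bigr => z _.
    by rewrite starZr bscalerAl bscalerAr scalerA -rcM qq fZ.
  apply: trsup_ge; first by apply: posZ => //; exact: ltW.
  split=> [_ /mapP[z zzs ->]|].
    by apply: (subspaceZ (ideal_subspace cI)); exact: Iz.
  have -> : sumsq (map (fun z => q%:C *: z) zs) = s%:C *: sumsq zs.
    rewrite /sumsq big_map scaler_sumr; apply: eq_bigr => z _.
    by rewrite starZr bscalerAl bscalerAr scalerA -rcM qq.
  by rewrite lmulZ -scalerBr; apply: posZ => //; exact: ltW.
apply/le_anti; rewrite h// andbT.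
have rV : 0 < r^-1 by rewrite invr_gt0.
have := h _ _ rV (posZ (ltW r0) pT).
by rewrite scalerA -rcM mulVf ?gt_eqF// scale1r ler_pdivrMl.
Qed.

(** * The linear extension of [trsup] to the algebra *)

Definition re a : A := 2^-1%:C *: (a + star a).

Lemma reD a b : re (a + b) = re a + re b.
Proof. by rewrite /re starD addrACA scalerDr. Qed.

Lemma reZ r a : re (r%:C *: a) = r%:C *: re a.
Proof. by rewrite /re starZr -scalerDr !scalerA mulrC. Qed.

Lemma reN a : re (- a) = - re a.
Proof. by rewrite /re starN -opprD scalerN. Qed.

Lemma star_re a : star (re a) = re a.
Proof. by rewrite /re starZr starD starK addrC. Qed.

Lemma nrm_re a : nrm (re a) <= nrm a.
Proof.
rewrite nrmZr ger0_norm ?invr_ge0// ler_pdivrMl//.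
by rewrite (le_trans (nrmD _ _))// nrm_star mulr2n mulrDl mul1r.
Qed.

Lemma re_sa a : star a = a -> re a = a.
Proof.
by move=> sa; rewrite /re sa; linear_eq R[i] A; field.
Qed.

Lemma re_i_sa a : star a = a -> re ('i%C *: a) = 0.
Proof. by move=> sa; rewrite /re starZ conj_i sa scaleNr subrr scaler0. Qed.

(** Real-linear extension of [trsup] through the self-adjoint part h of a, written as (h + |h|) -
    |h|. By additivity any other difference of positive multipliers gives the same value. *)
Definition retrace a : R :=
  trsup (lmul (re a) + msc (nrm (re a))) - trsup (msc (nrm (re a))).

Let pos_re a : pos (lmul (re a) + msc (nrm (re a))).
Proof.
rewrite addrC -[lmul _]opprK; apply: bnd_pos; last exact/bndN/bnd_lmul.
- by rewrite mstarN -lmul_star star_re.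
- exact: nrm_ge0.
Qed.

Lemma retraceE a S T : pos S -> pos T -> lmul (re a) = S - T ->
  retrace a = trsup S - trsup T.
Proof.
move=> pS pT E; have pa := pos_re a.
have pn := pos_msc (nrm_ge0 (re a)).
apply/eqP; rewrite /retrace subr_eq addrAC eq_sym subr_eq -!trsupD//.
by rewrite E addrAC subrK.
Qed.

Lemma retrace_pos a : star a = a -> pos (lmul a) -> retrace a = trsup (lmul a).
Proof.
move=> sa pa; rewrite (retraceE pa pos0) ?trsup0 ?subr0//.
by rewrite re_sa.
Qed.

Let retrace_dec a : exists S T, [/\ pos S, pos T & lmul (re a) = S - T].
Proof.
exists (lmul (re a) + msc (nrm (re a))), (msc (nrm (re a))).
by rewrite addrK; split=> //; exact/pos_msc/nrm_ge0.
Qed.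

Lemma retraceD a b : retrace (a + b) = retrace a + retrace b.
Proof.
have [[S [T [pS pT ab]]] [S' [T' [pS' pT' ab']]]] := (retrace_dec a, retrace_dec b).
rewrite (@retraceE a S T)// (@retraceE b S' T')//.
rewrite (retraceE (posD pS pS') (posD pT pT')); last first.
  by rewrite reD lmulD ab ab' opprD addrACA.
by rewrite !trsupD// opprD addrACA.
Qed.

Lemma retraceN a : retrace (- a) = - retrace a.
Proof.
have [S [T [pS pT ab]]] := retrace_dec a.
by rewrite (@retraceE a S T)// (retraceE pT pS) ?opprB// reN lmulN ab opprB.
Qed.

Lemma retraceZ r a : retrace (r%:C *: a) = r * retrace a.
Proof.
have h s : 0 <= s -> retrace (s%:C *: a) = s * retrace a.
  move=> s0; have [S [T [pS pT ab]]] := retrace_dec a.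
  rewrite (@retraceE a S T)// (retraceE (posZ s0 pS) (posZ s0 pT)).
    by rewrite !trsupZ// mulrBr.
  by rewrite reZ lmulZ ab scalerBr.
have [|/ltW r0] := leP 0 r; first exact: h.
rewrite -[r]opprK rcN scaleNr retraceN h ?oppr_ge0//; ring.
Qed.

Lemma retrace_le a : `|retrace a| <= 2 * nrm a.
Proof.
have h b : retrace b <= 2 * nrm b.
  have n0 := nrm_ge0 (re b).
  rewrite /retrace lerBlDr ler_wpDr ?trsup_ge0//; first exact: pos_msc.
  apply: (@le_trans _ _ (nrm (re b) + nrm (re b))).
    apply: trsup_bnd => //; first exact: addr_ge0.
    apply: bndD; first exact: bnd_lmul.
    by rewrite -[X in bnd _ X]ger0_norm//; exact: bnd_msc.
  by rewrite mulrDl mul1r lerD// nrm_re.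
by rewrite ler_norml h andbT -lerN2 opprK -retraceN -nrmN h.
Qed.

(** The complex-linear functional whose real part is [retrace]. *)
Definition trace a : R[i] := (retrace a)%:C - 'i%C * (retrace ('i%C *: a))%:C.

Lemma traceD a b : trace (a + b) = trace a + trace b.
Proof.
by rewrite /trace scalerDr !retraceD !rcD mulrDr opprD addrACA.
Qed.

Lemma traceZr r a : trace (r%:C *: a) = r%:C * trace a.
Proof.
rewrite /trace.
have -> : 'i%C *: (r%:C *: a) = r%:C *: ('i%C *: a) by rewrite !scalerA mulrC.
by rewrite !retraceZ !rcM; ring.
Qed.

Lemma trace_i a : trace ('i%C *: a) = 'i%C * trace a.
Proof.
have ii : 'i%C * 'i%C = - 1 :> R[i] by rewrite -expr2 sqr_i.
rewrite /trace scalerA ii scaleN1r retraceN rcN; ring: ii.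
Qed.

Lemma trace_scalar : scalar trace.
Proof.
move=> c a b; rewrite traceD; congr (_ + _).
rewrite [in LHS](complexE c) [in RHS](complexE c) scalerDl traceD traceZr.
by rewrite -scalerA trace_i traceZr mulrDl mulrA.
Qed.

Lemma trace0 : trace 0 = 0.
Proof. by apply: (addrI (trace 0)); rewrite -traceD !addr0. Qed.

Lemma trace_star_mul a :
  trace (star a ** a) = (trsup (mstar (lmul a) * lmul a))%:C.
Proof.
have sa : star (star a ** a) = star a ** a by rewrite starM starK.
rewrite /trace (@retraceE ('i%C *: _) 0 0); try exact: pos0; last first.
  by rewrite re_i_sa// lmul0 subrr.
rewrite subrr mulr0 subr0 retrace_pos// lmulM lmul_star//.
exact: pos_star_mul.
Qed.

(** The sesquilinear form [D] vanishes on the diagonal by [trsup_tr], hence everywhere by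
    polarization. *)
Lemma trace_comm a b : trace (a ** b) = trace (b ** a).
Proof.
have trD := traceD; have tri := trace_i.
have trN x : trace (- x) = - trace x.
  by apply: (addrI (trace x)); rewrite -trD !subrr trace0.
pose D x y : R[i] := trace (star x ** y) - trace (y ** star x).
have Dxx x : D x x = 0.
  have := trace_star_mul (star x); rewrite starK lmul_star mstarK => h.
  by rewrite /D trace_star_mul h trsup_tr subrr.
have Dxy x y : D x y + D y x = 0.
  have : D (x + y) (x + y) = D x x + D y y + (D x y + D y x).
    by rewrite /D starD !(bmulDl, bmulDr) !trD; ring.
  by rewrite !Dxx !add0r.
have Diy x y : D x ('i%C *: y) = 'i%C * D x y.
  by rewrite /D bscalerAl bscalerAr !tri; ring.
have Dix x y : D ('i%C *: x) y = - 'i%C * D x y.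
  rewrite /D starZ conj_i scaleNr bmulNl bmulNr !trN bscalerAl bscalerAr !tri.
  by ring.
have D0 x y : D x y = 0.
  have h1 := Dxy x y; have := Dxy x ('i%C *: y); rewrite Diy Dix => h2.
  have i0 : 'i%C != 0 :> R[i] by exact: neq0Ci.
  have : 2 * 'i%C * D x y = 0.
    transitivity ('i%C * D x y + - 'i%C * D y x + 'i%C * (D x y + D y x)).
      by ring.
    by rewrite h1 h2 mulr0 addr0.
  by move/eqP; rewrite !mulf_eq0 (negbTE i0) pnatr_eq0 => /eqP.
by have := D0 (star a) b; rewrite /D starK => /eqP; rewrite subr_eq0 => /eqP.
Qed.

Lemma trace_norm_le a : complex.Re `|trace a| <= 4 * nrm a.
Proof.
rewrite -lecR Re_norm (le_trans (ler_normB _ _))//.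
rewrite normrM -[X in X * _]Re_norm Re_norm_i mul1r.
have E r : `|r%:C| = `|r|%:C :> R[i].
  by rewrite normc_def /= expr0n addr0 sqrtr_sqr.
rewrite !E -rcD lecR; have := retrace_le ('i%C *: a); have := retrace_le a.
rewrite nrmZ Re_norm_i mul1r; lra.
Qed.

Lemma exists_tracial_state w : I w -> 0 < f (w ** star w) ->
  exists phi : {scalar A}, tracial_state phi.
Proof.
move=> Iw fw.
pose E := [set complex.Re `|trace a| | a in [set a : A | `|a| <= 1]].
have hE : has_sup E.
  split; first by exists (complex.Re `|trace 0|), 0 => //=; rewrite normr0.
  exists 4 => _ [a /= a1 <-]; rewrite (le_trans (trace_norm_le a))//.
  by rewrite ler_piMr// -nrm_le.
set s := star w ** w.
have ts : trace s = (trsup (mstar (lmul w) * lmul w))%:C by exact: trace_star_mul.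
have ts0 : 0 < trsup (mstar (lmul w) * lmul w).
  rewrite (lt_le_trans fw)//.
  have -> : f (w ** star w) = fsum [:: w] by rewrite /fsum big_seq1.
  apply: trsup_ge; first exact: pos_star_mul.
  split; first by move=> z; rewrite inE => /eqP ->.
  by rewrite lmul_sumsq_cons lmul_sumsq_nil addr0 subrr; exact: pos0.
have s0 : 0 < nrm s.
  rewrite lt_neqAle nrm_ge0 andbT eq_sym; apply/negP => /eqP/nrm_eq0 s0.
  move: ts; rewrite s0 trace0 => /(@complexI R) ts; by rewrite -ts ltxx in ts0.
(* The norm of [trace], finite by [hE] and positive because [trace s] is; dividing by it
   normalizes. *)
set N := sup E.
have N0 : 0 < N.
  pose b := (nrm s)^-1%:C *: s.
  have Eb : E (complex.Re `|trace b|).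
    exists b => //=; rewrite nrm_le nrmZr ger0_norm ?invr_ge0 ?nrm_ge0//.
    by rewrite mulVf ?gt_eqF.
  rewrite (@lt_le_trans _ _ (complex.Re `|trace b|))//; last first.
    by apply: ub_le_sup => //; case: hE.
  rewrite -ltcR Re_norm normr_gt0 traceZr ts -rcM.
  by apply/negP => /eqP/(@complexI R)/eqP; rewrite gt_eqF// mulr_gt0// invr_gt0.
pose phi a : R[i] := N^-1%:C * trace a.
have phi_scalar : scalar phi.
  by move=> c a b; rewrite /phi trace_scalar mulrDr mulrCA.
pose phiL := GRing.isLinear.Build R[i] A R[i] *%R phi phi_scalar.
pose psi : {scalar A} := HB.pack phi phiL.
have NV : 0 <= N^-1 by rewrite invr_ge0 ltW.
have phiE a : complex.Re `|phi a| = N^-1 * complex.Re `|trace a|.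
  apply: (@complexI R); rewrite rcM !Re_norm /phi normrM.
  by rewrite (@ger0_norm _ N^-1%:C)// lecR.
exists psi; split.
- move=> a /=; rewrite /phi trace_star_mul -rcM lecR mulr_ge0//.
  exact/trsup_ge0/pos_star_mul.
- rewrite /functional_norm /= -[X in sup X]/(
    [set complex.Re `|phi a| | a in [set a : A | `|a| <= 1]]).
  set E' := [set _ | _ in _].
  have E'1 : ubound E' 1.
    move=> _ [a a1 <-]; rewrite phiE ler_pdivrMl// mulr1.
    by apply: ub_le_sup; [case: hE|exists a].
  apply/le_anti/andP; split.
    apply: ge_sup => //; exists (complex.Re `|phi 0|), 0 => //=.
    by rewrite normr0.
  rewrite -(ler_pM2l N0) mulr1; apply: ge_sup; first by case: hE.
  move=> _ [a a1 <-]; rewrite -ler_pdivrMl// -phiE.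
  by apply: ub_le_sup; [exists 1|exists a].
- by move=> a b /=; rewrite /phi trace_comm.
Qed.

End TraceExtension.

(** * C*-algebras without tracial states *)

Section NoTracialState.
Context {R : realType} {A : cstarAlgType R}.
Implicit Types (x y z w a : A) (I : set A).
Hypothesis no_trace : ~ exists phi : {scalar A}, tracial_state phi.

(* Were [f], or one of [- f], [f ('i .)], [- f ('i .)], positive at some square
   [w w^*] with [w] in [I], its [trsup] would yield a tracial state. So [f]
   vanishes at these squares and, by polarization, at the products [x u^*]. *)
Lemma no_trace_vanish I (f : A -> R) x u : closed_ideal I ->
  (forall x y, f (x + y) = f x + f y) ->
  (forall r x, f (r%:C *: x) = r * f x) -> (forall x, f x <= nrm x) ->
  (forall z a, I z -> f (commutator z a) = 0) ->
  I x -> I u -> f (x ** star u) = 0.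
Proof.
move=> cI fD fZ fb f0 Ix Iu.
pose g a := f ('i%C *: a).
have le (h : A -> R) : (forall x y, h (x + y) = h x + h y) ->
    (forall r x, h (r%:C *: x) = r * h x) -> (forall x, h x <= nrm x) ->
    (forall z a, I z -> h (commutator z a) = 0) ->
    forall w, I w -> h (w ** star w) <= 0.
  move=> hD hZ hb h0 w Iw; rewrite leNgt; apply/negP => hw; apply: no_trace.
  exact: (exists_tracial_state cI hD hZ hb h0 Iw hw).
have fN y : f (- y) = - f y.
  apply: (addrI (f y)); rewrite -fD !subrr.
  by apply: (addrI (f 0)); rewrite -fD !addr0.
have eq (h : A -> R) : (forall x y, h (x + y) = h x + h y) ->
    (forall r x, h (r%:C *: x) = r * h x) -> (forall x, h x <= nrm x) ->
    (forall y, h (- y) = - h y) ->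
    (forall z a, I z -> h (commutator z a) = 0) ->
    forall w, I w -> h (w ** star w) = 0.
  move=> hD hZ hb hN h0 w Iw; apply/le_anti; rewrite (le h)//= -oppr_le0.
  apply: (le (fun a => - h a)) => //.
  - by move=> y z; rewrite hD opprD.
  - by move=> r y; rewrite hZ mulrN.
  - by move=> y; rewrite -hN -nrmN.
  - by move=> z a Iz; rewrite h0 ?oppr0.
have sI := ideal_subspace cI.
have f_sq := eq f fD fZ fb fN f0.
have g_sq : forall w, I w -> g (w ** star w) = 0.
  apply: eq => [y z|r y|y|y|z a Iz]; rewrite /g.
  - by rewrite scalerDr fD.
  - by rewrite scalerA mulrC -scalerA fZ.
  - by rewrite (le_trans (fb _))// nrmZ Re_norm_i mul1r.
  - by rewrite scalerN fN.
  - by rewrite -commutatorZl f0//; exact: subspaceZ.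
have pol (h : A -> R) : (forall x y, h (x + y) = h x + h y) ->
    (forall w, I w -> h (w ** star w) = 0) ->
    forall y z, I y -> I z -> h (y ** star z) + h (z ** star y) = 0.
  move=> hD h0 y z Iy Iz; have := h0 (y + z) (subspaceD sI Iy Iz).
  by rewrite starD !(bmulDl, bmulDr) !hD !h0// add0r addr0 addrC.
have gD y z : g (y + z) = g y + g z by rewrite /g scalerDr fD.
have star_i y : star ('i%C *: y) = - ('i%C *: star y).
  by rewrite starZ conj_i scaleNr.
have g0 y z : I y -> I z -> g (y ** star z) = 0.
  move=> Iy Iz; have h1 := pol g gD g_sq _ _ Iy Iz.
  have := pol f fD f_sq _ _ Iy (subspaceZ sI 'i%C Iz).
  rewrite star_i bmulNr bscalerAr bscalerAl fN -/(g _) -/(g (z ** _)) => h2.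
  by lra.
(* The value of [g] at -i times an element is that of [f] at the element. *)
have := g0 _ _ (subspaceZ sI (- 'i%C) Ix) Iu.
rewrite /g bscalerAl scalerA mulrN.
by rewrite (_ : 'i%C * 'i%C = - 1) ?opprK ?scale1r// -expr2 sqr_i.
Qed.

(** A functional separating [x] from the commutators would vanish at x u for self-adjoint u in [I],
    yet x u can be taken within f x / 2 of x. *)
Lemma no_trace_commspan I : closed_ideal I -> closure (commspan I setT) = I.
Proof.
move=> cI; apply/seteqP; split; first exact: closure_commspan_ideal.
move=> x Ix; apply: contrapT => nx.
have [f [fD fZ fb f0 fx]] :=
  hahn_banach_separation (commspan_subspace I setT) nx.
have [u [Iu su xu]] := cstar_ideal_approx cI Ix (divr_gt0 fx (ltr0Sn R 1)).
have fxu : f (x ** u) = 0.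
  rewrite -su; apply: (no_trace_vanish cI fD fZ fb) => // z a Iz.
  by apply: f0; exact: commspan_mem.
have := fb (x - x ** u); rewrite leNgt => /negP; apply.
rewrite (le_lt_trans xu)//.
have := fD (x - x ** u) (x ** u); rewrite subrK fxu addr0 => <-.
by rewrite ltr_pdivrMr// ltr_pMr// ltr1n.
Qed.

End NoTracialState.

Unset Implicit Arguments.

Theorem corollary4p9 (R : realType) :
  (forall A : banachAlgType R,
     (forall J : set A, closed_ideal J -> admits_qcai J) ->
     forall I : set A, closed_ideal I ->
       [/\ closure (commspan I I) = closure (commspan I setT),
           closure (commspan I setT) = closure (commspan I (commspan I setT)) &
           closure (commspan I (commspan I setT))
             = I `&` closure (commspan setT setT)]) /\
  (forall A : cstarAlgType R,
     (~ exists phi : {scalar A}, tracial_state phi) ->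
     forall I : set A, closed_ideal I -> closure (commspan I setT) = I).
Proof.
split=> [A qcai I cI|A no_trace I cI]; last exact: no_trace_commspan.
have IAE := closure_commspan_commspan qcai cI.
split=> //; first exact: closure_commspan_self.
by rewrite -IAE; exact: closure_commspan_cap.
Qed.
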